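(* Suppose the following hypothesis (H) holds. (H) For every integer $d\ge 3$ there exist constants $C_1,C_2$ such that every $\mu$-minimal $d$-regular graph $G$ with at least $C_1$ vertices is path-like, and there is a partition $V(G)=A\cup M\cup B$ with $|A|+|B|\le C_2$ such that: the subgraph induced by $M$ is the sequential join of $3m$ complete graphs (for some $m$) whose orders follow the periodic pattern $1,\,d-1,\,1,\,1,\,d-1,\,1,\ldots,1,\,d-1,\,1$ when $d$ is odd, and $1,\,d-2,\,2,\,1,\,d-2,\,2,\ldots,1,\,d-2,\,2$ when $d$ is even; every edge between $M$ and $A$ has its endpoint in $M$ in the first of these complete graphs; every edge between $M$ and $B$ has its endpoint in $M$ in the last of these complete graphs; and there are no edges between $A$ and $B$. Then the Aldous--Fill conjecture holds: the maximum relaxation time of the random walk over all connected regular graphs on $n$ vertices is $(1+o(1))\frac{3n^2}{2\pi^2}$ as $n\to\infty$.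
   Context: All graphs are simple and connected. For a graph $G$ with adjacency matrix $A$ and diagonal degree matrix $\Delta$, the Laplacian is $L(G)=\Delta-A$, and the algebraic connectivity $\mu(G)$ is the second smallest eigenvalue of $L(G)$. The relaxation time of the random walk on $G$ is $\tau=1/(1-\eta_2)$, where $\eta_2$ is the second largest eigenvalue of the transition matrix $\Delta^{-1}A$ (for a $d$-regular graph, $\tau=d/\mu(G)$). A $d$-regular graph on $n$ vertices is $\mu$-minimal if it has the smallest $\mu$ among all $d$-regular graphs on $n$ vertices. A graph is path-like if it has at least two blocks (maximal connected subgraphs without cut vertices) and its block-tree is a path. The sequential join $G_1+G_2+\cdots+G_k$ of vertex-disjoint graphs is obtained from $G_1\cup\cdots\cup G_k$ by joining every vertex of $G_i$ to every vertex of $G_{i+1}$ for $i=1,\ldots,k-1$.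
   Formalization: The maximum relaxation time is shown to be (1+o(1))3n²/(2π²) along even n only; for all n only the upper bound (1+o(1))3n²/(2π²) is stated, because for odd n the degree is even and under (H) the value is not attained. *)

(* Defs.v *)
From mathcomp Require Import all_boot all_order all_algebra.
From mathcomp Require Import all_classical all_reals all_analysis.

Set Implicit Arguments.
Unset Strict Implicit.
Unset Printing Implicit Defensive.

Import Order.TTheory GRing.Theory Num.Theory.
Import numFieldNormedType.Exports.

Local Open Scope ring_scope.

(* Up to isomorphism, every graph on n vertices has vertex set 'I_n. *)
Record sgraph (n : nat) := SGraph {
  adj :> rel 'I_n;
  adj_sym : symmetric adj;
  adj_irr : irreflexive adj }.

Section Graphs.
Variables (n : nat) (G : sgraph n).
Implicit Types (x y v : 'I_n) (S : {set 'I_n}).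
Local Open Scope set_scope.

Definition deg x : nat := #|[set y | G x y]%SET|.

Definition regular (d : nat) : Prop := forall x, deg x = d.

Definition connected_on S : bool :=
  [forall x in S, forall y in S,
     connect [rel u v | [&& u \in S, v \in S & G u v]] x y].

Definition connected : bool := connected_on [set: 'I_n]%SET.

Definition cut_vertex_of S v : bool :=
  (v \in S) && ~~ connected_on (S :\ v).

(* A maximal connected subgraph without cut vertices is induced, so blocks are
   represented by their vertex sets. *)
Definition block S : bool :=
  maxset [pred T : {set 'I_n} | [&& T != finset.set0, connected_on T &
                  [forall v, ~~ cut_vertex_of T v]]] S.

(* Nodes of the block-tree: the blocks and the cut vertices of G; a cut vertex
   is adjacent to the blocks that contain it. *)
Definition bt_node (t : {set 'I_n} + 'I_n) : bool :=
  match t with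
  | inl B => block B
  | inr v => cut_vertex_of [set: 'I_n]%SET v
  end.

Definition bt_adj : rel ({set 'I_n} + 'I_n) := fun t u =>
  match t, u with
  | inl B, inr v | inr v, inl B => v \in B
  | _, _ => false
  end.

End Graphs.

Definition is_path_graph (T : finType) (N : pred T) (e : rel T) : Prop :=
  exists s : seq T, [/\ uniq s, s =i N &
    {in N &, forall t u,
      e t u = (index u s == (index t s).+1) || (index t s == (index u s).+1)}].

Definition path_like (n : nat) (G : sgraph n) : Prop :=
  (1 < #|[set S | block G S]%SET|)%N /\ is_path_graph (bt_node G) (@bt_adj n).

(* The subgraph of G induced by M is the sequential join
   G[P 0] + ... + G[P (k - 1)]; only the sets P i with i < k matter. *)
Definition seq_join (n : nat) (G : sgraph n) (M : {set 'I_n}) (k : nat)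
    (P : nat -> {set 'I_n}) : Prop :=
  [/\ M = (\bigcup_(i < k) P i)%SET,
      forall i j, (i < j < k)%N -> [disjoint P i & P j],
      forall i x y, (i.+1 < k)%N -> x \in P i -> y \in P i.+1 -> G x y &
      forall i j x y, (i.+1 < j < k)%N -> x \in P i -> y \in P j -> ~~ G x y].

Definition clique (n : nat) (G : sgraph n) (S : {set 'I_n}) : Prop :=
  {in S &, forall x y, x != y -> G x y}.

Definition pattern (d i : nat) : nat :=
  nth 0%N (if odd d then [:: 1; d - 1; 1] else [:: 1; d - 2; 2])%N (i %% 3)%N.

Definition patterned (n : nat) (G : sgraph n) (d C2 : nat) : Prop :=
  exists (A M B : {set 'I_n}) (m : nat) (P : nat -> {set 'I_n}),
    [/\ [/\ A :|: M :|: B = [set: 'I_n],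
            [disjoint A & M], [disjoint A & B] & [disjoint M & B]]%SET,
        (#|A| + #|B| <= C2)%N,
        [/\ (0 < m)%N, seq_join G M (3 * m) P,
            forall i, (i < 3 * m)%N -> clique G (P i) &
            forall i, (i < 3 * m)%N -> #|P i| = pattern d i],
        [/\ forall x y, x \in M -> y \in A -> G x y -> x \in P 0%N &
            forall x y, x \in M -> y \in B -> G x y -> x \in P (3 * m).-1] &
        forall x y, x \in A -> y \in B -> ~~ G x y].

Section Spectra.
Variable R : realType.
Local Open Scope classical_set_scope.

(* The eigenvalues of M with (algebraic) multiplicity, in nondecreasing order;
   meaningful when the characteristic polynomial splits over R, which is the
   case for the two graph matrices below since L is symmetric and
   Delta^-1 A is similar to a symmetric matrix. *)
Definition spectrum (n : nat) (M : 'M[R]_n) : seq R :=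
  xget [::] [set s : seq R | sorted <=%R s /\
                 char_poly M = \prod_(x <- s) ('X - x%:P)].

Lemma spectrumE (n : nat) (M : 'M[R]_n) (s : seq R) :
  sorted <=%R s -> char_poly M = \prod_(x <- s) ('X - x%:P) -> spectrum M = s.
Proof.
move=> s_sorted sE; apply: xget_unique => // t [t_sorted tE].
apply: (sorted_eq le_trans le_anti) => //.
by apply: prod_XsubC_eq; rewrite -sE -tE.
Qed.

Definition adj_mx (n : nat) (G : sgraph n) : 'M[R]_n :=
  \matrix_(i, j) (G i j)%:R.

Definition deg_mx (n : nat) (G : sgraph n) : 'M[R]_n :=
  diag_mx (\row_i (deg G i)%:R).

Definition laplacian (n : nat) (G : sgraph n) : 'M[R]_n :=
  deg_mx G - adj_mx G.

Definition alg_connectivity (n : nat) (G : sgraph n) : R :=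
  nth 0 (spectrum (laplacian G)) 1.

Definition transition_mx (n : nat) (G : sgraph n) : 'M[R]_n :=
  invmx (deg_mx G) *m adj_mx G.

Definition eta2 (n : nat) (G : sgraph n) : R :=
  nth 0 (rev (spectrum (transition_mx G))) 1.

Definition relaxation_time (n : nat) (G : sgraph n) : R := 1 / (1 - eta2 G).

Definition mu_minimal (d n : nat) (G : sgraph n) : Prop :=
  [/\ connected G, regular G d &
      forall H : sgraph n, connected H -> regular H d ->
        alg_connectivity G <= alg_connectivity H].

Definition mu_minimal_structure : Prop :=
  forall d : nat, (3 <= d)%N -> exists C1 C2 : nat,
    forall (n : nat) (G : sgraph n), (C1 <= n)%N -> mu_minimal d G ->
      path_like G /\ patterned G d C2.

Definition relaxation_times (n : nat) : set R :=
  [set t | exists G : sgraph n,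
     [/\ connected G, exists d, regular G d & t = relaxation_time G]].

(* The maximum of the finite set relaxation_times n. *)
Definition max_relaxation_time (n : nat) : R :=
  xget 0 (relaxation_times n `&` ubound (relaxation_times n)).

Definition aldous_fill_value (n : nat) : R :=
  3 * n%:R ^+ 2 / (2 * pi ^+ 2).

(* The value is an asymptotic upper bound along all n, and the asymptotic value
   along even n.  For odd n every regular graph has even degree, and the chains
   with pattern 1, d - 2, 2 have relaxation time asymptotic to
   d / (2 (d - 2)) * n^2 / pi^2 <= n^2 / pi^2, so the value is
   not attained there. *)
Definition aldous_fill : Prop :=
  (forall e : R, 0 < e ->
     \forall n \near \oo,
       max_relaxation_time n <= (1 + e) * aldous_fill_value n) /\
  ((fun k : nat => max_relaxation_time k.*2 / aldous_fill_value k.*2)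
     @ \oo --> (1 : R)).

End Spectra.

(* Main.v *)
Require Import Defs.
From mathcomp Require Import all_boot all_order all_algebra.
From mathcomp Require Import all_classical all_reals all_analysis.
From mathcomp Require Import perm spectral complex.
From mathcomp Require Import ring lra zify.

Set Implicit Arguments.
Unset Strict Implicit.
Unset Printing Implicit Defensive.

Import Order.TTheory GRing.Theory Num.Theory.
Import numFieldNormedType.Exports.

Local Open Scope ring_scope.

(* For a d-regular graph the relaxation time is d / mu, and mu^-1 is the best
   constant K in the Poincare inequality  sum f^2 <= K * energy f  (sum f = 0).

   Large d, without the hypothesis.  Sort the vertices by f and let e_k be the number
   of edges across the k-th cut.  Counting degrees between two cuts gives
   e_k + e_(k+j) >= j (d + 1 - j), so cuts with fewer than d/2 edges are at least
   d + 1 apart (the empty cuts at both ends included), while the others contribute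
   o(1) per block of d + 1 cuts to the total resistance sum_k 1 / e_k.  A Schur test
   with a constant vector on the sorted path then gives a relaxation time of at most
   (1 + o_d(1)) n^2 / 8, and 1/8 < 3 / (2 pi^2) because pi^2 < 12.  The cases d = 1, 2
   follow in the same way from e_k >= d.

   The finitely many remaining d.  The hypothesis makes a mu-minimal graph, up to
   boundedly many vertices, a chain of about n / (d + 1) periods of d + 1 vertices and
   resistance (d + 1) / (p1 p2) each, with p1 and p2 the orders of the two larger
   layers.  Wirtinger's inequality on a path yields a relaxation time asymptotic to at
   most d / (p1 p2) * n^2 / pi^2, and d / (p1 p2) <= 3 / 2.

   Lower bound.  For even n a cubic connected graph exists, so a mu-minimal one exists
   and has the above shape; the cosine, interpolated linearly in the resistance, is a
   test function showing that 3 / (2 pi^2) is attained asymptotically. *)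

(** * Spectrum and Poincare inequality *)

(** The obstacle is uniformity in [d]. The constants [C1] and [C2] come with each degree and may
    grow with it, while the maximum runs over all degrees below [n]; so the degrees beyond some
    absolute threshold need an argument that does not call on them. That argument may be lossy. On a
    unit path the sharp constant is 1 / pi^2, and the Schur test with a constant vector replaces it
    by the largest row sum of the Green function, max k (n - k) / 2 = n^2 / 8. This is worse than
    n^2 / pi^2 but still below the target, because the target belongs to [d = 3]: the factor d / (p1
    p2) is d / (d - 1) for odd [d] and d / (2 (d - 2)) for even [d], so it equals 3 / 2 at [d = 3]
    and is smaller elsewhere. Minimality of mu makes the hypothesis speak about all graphs: a
    Poincare constant of one mu-minimal graph bounds the relaxation time of every connected graph of
    the same degree and order. *)

Section Diagonalisation.
Variable R : realType.
Local Notation C := R[i].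
Local Notation toC := (real_complex R).
Local Open Scope sesquilinear_scope.

(** A real symmetric matrix is Hermitian over [R[i]], where the spectral theorem gives a unitary [P]
    and real eigenvalues. The basis stays complex; real eigenvectors are recovered later as real and
    imaginary parts. *)
Lemma real_symmetric_diag (n : nat) (A : 'M[R]_n) : A^T = A ->
  exists (P : 'M[C]_n) (D : 'I_n -> R), P \is unitarymx /\
    map_mx toC A = P^t* *m diag_mx (\row_i toC (D i)) *m P.
Proof.
move=> symA; set B := map_mx toC A.
have Breal : B \is a mxOver Num.real.
  by apply/mxOverP => i j; rewrite mxE; apply/complex_realP; exists (A i j).
have Bsym : B \is symmetricmx.
  by apply/is_hermitianmxP; rewrite expr0 scale1r map_mx_id // map_trmx symA.
have Bherm := realsym_hermsym Bsym Breal.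
have /orthomx_spectralP BE := hermitian_normalmx Bherm.
have Dreal := mxOverP (hermitian_spectral_diag_real Bherm).
exists (spectralmx B), (fun i => complex.Re (spectral_diag B 0 i)).
split; first exact: spectral_unitarymx.
rewrite -(invmx_unitary (spectral_unitarymx B)) [LHS]BE.
congr (_ *m diag_mx _ *m _).
by apply/rowP => i; rewrite mxE RRe_real.
Qed.

Lemma char_poly_diag (n : nat) (A : 'M[R]_n) (P : 'M[C]_n) (D : 'I_n -> R) :
  P \is unitarymx ->
  map_mx toC A = P^t* *m diag_mx (\row_i toC (D i)) *m P ->
  char_poly A = \prod_i ('X - (D i)%:P).
Proof.
move=> Pu AE; apply: (map_poly_inj toC).
rewrite map_char_poly AE rmorph_prod /=.
have -> : char_poly (P^t* *m diag_mx (\row_i toC (D i)) *m P) =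
    char_poly (diag_mx (\row_i toC (D i))).
  rewrite /char_poly /char_poly_mx !map_mxM.
  set Q := map_mx polyC P; set S := map_mx polyC (P^t*).
  have SQ : S *m Q = 1%:M.
    by rewrite -map_mxM (mulmx1C (unitarymxP Pu)) map_mx1.
  have -> : 'X%:M - S *m map_mx polyC (diag_mx (\row_i toC (D i))) *m Q =
      S *m ('X%:M - map_mx polyC (diag_mx (\row_i toC (D i)))) *m Q.
    by rewrite mulmxBr mulmxBl mul_mx_scalar -scalemxAl SQ scalemx1.
  by rewrite !det_mulmx mulrAC -det_mulmx SQ det1 mul1r.
rewrite char_poly_trig ?diag_mx_is_trig //.
apply: eq_bigr => i _.
by rewrite !mxE eqxx mulr1n rmorphB /= map_polyX map_polyC.
Qed.

(** The ordering [s] is a parameter because the transition matrix shares the eigenbasis of the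
    Laplacian but lists its eigenvalues in the opposite order. *)
Lemma spectrum_diag (n : nat) (A : 'M[R]_n) (P : 'M[C]_n) (D : 'I_n -> R)
    (s : seq 'I_n) :
  P \is unitarymx ->
  map_mx toC A = P^t* *m diag_mx (\row_i toC (D i)) *m P ->
  perm_eq s (enum 'I_n) -> sorted <=%R (map D s) -> spectrum A = map D s.
Proof.
move=> Pu AE s_perm s_sorted; apply: spectrumE => //.
by rewrite (char_poly_diag Pu AE) big_map (perm_big _ s_perm) /= big_enum.
Qed.

End Diagonalisation.

Section Energy.
Variables (R : realType) (n : nat) (G : sgraph n).
Implicit Types f : 'I_n -> R.

Definition energy f : R :=
  (\sum_x \sum_y (G x y)%:R * (f x - f y) ^+ 2) / 2.

Definition poincare (C : R) : Prop :=
  forall f, \sum_x f x = 0 -> \sum_x f x ^+ 2 <= C * energy f.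

Lemma energy_ge0 f : 0 <= energy f.
Proof.
rewrite divr_ge0 // sumr_ge0 // => x _; rewrite sumr_ge0 // => y _.
by rewrite mulr_ge0 ?sqr_ge0.
Qed.

Lemma energyBc f c : energy (fun x => f x - c) = energy f.
Proof.
congr (_ / 2); apply: eq_bigr => x _; apply: eq_bigr => y _.
by congr (_ * _ ^+ 2); ring.
Qed.

Lemma degE x : (deg G x)%:R = \sum_y (G x y)%:R :> R.
Proof.
rewrite /deg -sum1_card natr_sum big_mkcond /=.
by apply: eq_bigr => y _; rewrite inE; case: (G x y).
Qed.

Lemma laplacian_sym : (laplacian R G)^T = laplacian R G.
Proof.
rewrite /laplacian linearB /= tr_diag_mx; congr (_ - _).
by apply/matrixP => i j; rewrite !mxE adj_sym.
Qed.

Lemma mulmx_laplacian (u : 'rV[R]_n) y :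
  (u *m laplacian R G) 0 y = \sum_x (G x y)%:R * (u 0 y - u 0 x).
Proof.
rewrite /laplacian mulmxBr mul_mx_diag !mxE degE mulr_sumr -sumrB.
apply: eq_bigr => x _; rewrite !mxE (adj_sym G y x); ring.
Qed.

Lemma const_mulmx_laplacian (c : R) :
  (const_mx c : 'rV[R]_n) *m laplacian R G = 0.
Proof.
apply/rowP => y; rewrite mulmx_laplacian [RHS]mxE big1 // => x _.
by rewrite !mxE subrr mulr0.
Qed.

Lemma form_laplacian (u : 'rV[R]_n) :
  \sum_y (u *m laplacian R G) 0 y * u 0 y = energy (fun x => u 0 x).
Proof.
under eq_bigr do rewrite mulmx_laplacian mulr_suml.
(* The same sum seen from the other end of each edge; adding the two forms yields the square. *)
set S := LHS; have SE : S = \sum_y \sum_x (G x y)%:R * (u 0 x - u 0 y) * u 0 x.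
  rewrite /S exchange_big /=; apply: eq_bigr => x _; apply: eq_bigr => y _.
  by rewrite adj_sym.
apply: (@mulIf _ 2) => //; rewrite divfK // mulr_natr mulr2n {2}SE -big_split /=.
rewrite exchange_big /=.
rewrite exchange_big /=; apply: eq_bigr => y _.
rewrite -big_split /=; apply: eq_bigr => x _; rewrite (adj_sym G y x); ring.
Qed.

(** The mean minimises the sum of squared deviations, so an upper bound may centre [f] at whatever
    [c] suits the path. *)
Lemma variance_min f c : \sum_x f x = 0 ->
  \sum_x f x ^+ 2 <= \sum_x (f x - c) ^+ 2.
Proof.
move=> f0; have -> : \sum_x (f x - c) ^+ 2 =
    \sum_x f x ^+ 2 - 2 * c * \sum_x f x + \sum_(x < n) c ^+ 2.
  rewrite mulr_sumr -sumrB -big_split /=.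
  by apply: eq_bigr => x _; ring.
by rewrite f0 mulr0 subr0 lerDl sumr_ge0 // => x _; rewrite sqr_ge0.
Qed.

End Energy.

Section SpectralGap.
Variables (R : realType) (n : nat) (G : sgraph n).
Local Notation C := R[i].
Local Notation toC := (real_complex R).
Local Open Scope sesquilinear_scope.

Lemma laplacian_eigenbasis : (1 < n)%N ->
  exists (P : 'M[C]_n) (D : 'I_n -> R) (s : seq 'I_n),
    [/\ P \is unitarymx,
        map_mx toC (laplacian R G) = P^t* *m diag_mx (\row_i toC (D i)) *m P,
        perm_eq s (enum 'I_n) & sorted <=%R (map D s)].
Proof.
move=> n1; have [P [D [Pu LE]]] := real_symmetric_diag (laplacian_sym R G).
exists P, D, (sort (fun i j => D i <= D j) (enum 'I_n)).
split=> //; first by rewrite perm_sort.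
rewrite sorted_map; apply: (@sort_sorted _ (fun i j => D i <= D j)).
by move=> i j; exact: le_total.
Qed.

(** Regularity turns the transition matrix into [1 - laplacian / d]: same eigenbasis, eigenvalues
    [1 - D i / d], order reversed, so [eta2] comes from the second smallest [D i]. *)
Lemma relaxation_timeE d : (1 < n)%N -> (0 < d)%N -> regular G d ->
  relaxation_time R G = d%:R / alg_connectivity R G.
Proof.
move=> n1 d0 reg; have [P [D [s [Pu LE s_perm s_sorted]]]] := laplacian_eigenbasis n1.
have d0' : d%:R != 0 :> R by rewrite pnatr_eq0 -lt0n.
have size_s : size s = n by rewrite (perm_size s_perm) size_enum_ord.
rewrite /relaxation_time /eta2 /alg_connectivity (spectrum_diag Pu LE s_perm s_sorted).
have degE : deg_mx R G = d%:R%:M.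
  by apply/matrixP => i j; rewrite !mxE reg eq_sym; case: eqP => // ->.
have TE : transition_mx R G = 1%:M - d%:R^-1 *: laplacian R G.
  rewrite /transition_mx /laplacian degE invmx_scalar mul_scalar_mx scalerBr.
  by rewrite scale_scalar_mx mulVf // subKr.
pose D' i := 1 - D i / d%:R.
have TE' : map_mx toC (transition_mx R G) =
    P^t* *m diag_mx (\row_i toC (D' i)) *m P.
  rewrite TE map_mxB map_mx1 map_mxZ LE.
  have -> : diag_mx (\row_i toC (D' i)) =
      1%:M - toC d%:R^-1 *: diag_mx (\row_i toC (D i)).
    apply/matrixP => i j; rewrite !mxE /D'; case: eqP => // _.
      by rewrite !mulr1n rmorphB rmorph1 rmorphM mulrC.
    by rewrite !mulr0n mulr0 subr0.
  rewrite mulmxBr mulmxBl mulmx1 -scalemxAr -scalemxAl.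
  by rewrite (mulmx1C (unitarymxP Pu)).
have D'_sorted : sorted <=%R (map D' (rev s)).
  rewrite map_rev rev_sorted /D'.
  rewrite (map_comp (fun x => 1 - x / d%:R) D).
  rewrite sorted_map; apply: (sub_sorted _ s_sorted) => x y xy /=.
  by rewrite lerB // ler_pM2r // invr_gt0 ltr0n.
have rs_perm : perm_eq (rev s) (enum 'I_n) by rewrite perm_rev.
rewrite (spectrum_diag Pu TE' rs_perm D'_sorted) map_rev revK.
rewrite (nth_map (Ordinal n1)) ?size_s // (nth_map (Ordinal n1)) ?size_s //.
by rewrite /D' subKr invf_div mul1r.
Qed.

Lemma alg_connectivityP : (1 < n)%N ->
  exists (P : 'M[C]_n) (D : 'I_n -> R) (i0 i1 : 'I_n),
    [/\ P \is unitarymx,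
        map_mx toC (laplacian R G) = P^t* *m diag_mx (\row_i toC (D i)) *m P,
        i0 != i1, D i0 <= D i1 &
        alg_connectivity R G = D i1 /\ forall i, i != i0 -> D i1 <= D i].
Proof.
move=> n1; have [P [D [s [Pu LE s_perm s_sorted]]]] := laplacian_eigenbasis n1.
rewrite /alg_connectivity (spectrum_diag Pu LE s_perm s_sorted).
have size_s : size s = n by rewrite (perm_size s_perm) size_enum_ord.
have s_uniq : uniq s by rewrite (perm_uniq s_perm) enum_uniq.
have s_mem i : i \in s by rewrite (perm_mem s_perm) mem_enum.
case: s size_s s_uniq s_mem {s_perm} s_sorted => [|i0 [|i1 s]] /= size_s.
- by rewrite -size_s in n1.
- by rewrite -size_s in n1.
move=> /andP[i0s _] s_mem /andP[D01 D1s].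
exists P, D, i0, i1; split=> //.
  by apply: contraNneq i0s => ->; rewrite mem_head.
split=> // i ne_i0; have := s_mem i; rewrite !inE (negPf ne_i0) /=.
case/predU1P => [->//|is_s].
have := D1s; rewrite (path_sortedE le_trans) => /andP[/allP D1 _].
by apply: D1; apply: map_f.
Qed.

(** Both the Laplacian and [D i] are real, so the eigenvector equation splits into real and
    imaginary parts. *)
Lemma eigenvector_Re_Im (P : 'M[C]_n) (D : 'I_n -> R) i :
  P \is unitarymx ->
  map_mx toC (laplacian R G) = P^t* *m diag_mx (\row_i toC (D i)) *m P ->
  [/\ map_mx (@complex.Re R) (row i P) *m laplacian R G =
        D i *: map_mx (@complex.Re R) (row i P) &
      map_mx (@complex.Im R) (row i P) *m laplacian R G =
        D i *: map_mx (@complex.Im R) (row i P)].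
Proof.
move=> Pu LE.
have eig : row i P *m map_mx toC (laplacian R G) = toC (D i) *: row i P.
  rewrite LE !mulmxA -row_mul (unitarymxP Pu) row1 -rowE row_diag_mx.
  by rewrite -scalemxAl -rowE mxE.
by split; apply/rowP => j; move/rowP/(_ j): eig; rewrite !mxE;
   under eq_bigr => k do rewrite !mxE; move=> eig;
   [move/(congr1 (@complex.Re R)): eig | move/(congr1 (@complex.Im R)): eig];
   rewrite !raddf_sum /=; case: (P i j) => a b /=; rewrite mul0r ?subr0 ?addr0 => <-;
   apply: eq_bigr => k _;
   rewrite !mxE; case: (P i k) => a' b' /=; ring.
Qed.

(** For [D != 0] symmetry makes [u] orthogonal to the constants, and Poincare gives
    [sum u^2 <= K * D * sum u^2] with [K * D < 1], so [u = 0]. For [D = 0] the energy of [u]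
    vanishes, hence so does [u] minus its mean. *)
Lemma eigenvector_const (u : 'rV[R]_n) (K D : R) : 0 < K -> poincare G K ->
  D < K^-1 -> u *m laplacian R G = D *: u -> exists a, u = const_mx a.
Proof.
move=> K0 GK DK uL.
have energyE : energy G (fun x => u 0 x) = D * \sum_x u 0 x ^+ 2.
  rewrite -form_laplacian mulr_sumr; apply: eq_bigr => x _.
  by rewrite uL mxE; ring.
have sum_u : D * \sum_x u 0 x = 0.
  have : (u *m laplacian R G) *m (const_mx 1 : 'rV[R]_n)^T = 0.
    rewrite -mulmxA -(laplacian_sym R G) -trmx_mul const_mulmx_laplacian.
    by rewrite trmx0 mulmx0.
  move=> /matrixP/(_ 0 0); rewrite uL !mxE => uD.
  by rewrite -[RHS]uD mulr_sumr; apply: eq_bigr => x _; rewrite !mxE mulr1.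
have sqr_eq0 f : \sum_(x < n) f x ^+ 2 <= 0 -> forall x, f x = 0 :> R.
  move=> f0 x; apply/eqP; rewrite -sqrf_eq0 eq_le sqr_ge0 andbT.
  apply: le_trans f0; rewrite (bigD1 x) //= lerDl sumr_ge0 // => y _.
  exact: sqr_ge0.
have [D0|D_neq0] := eqVneq D 0.
  have [n0|n_gt0] := posnP n.
    by exists 0; apply/rowP => -[m m_n]; exfalso; rewrite n0 in m_n.
  pose c := (\sum_x u 0 x) / n%:R.
  exists c; apply/rowP => x; rewrite mxE; apply/eqP; rewrite -subr_eq0.
  apply/eqP; move: x; apply: (sqr_eq0 (fun x => u 0 x - c)).
  apply: le_trans (GK _ _) _.
    rewrite sumrB sumr_const card_ord -mulr_natr /c divfK ?subrr //.
    by rewrite pnatr_eq0 -lt0n.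
  by rewrite energyBc energyE D0 mul0r mulr0.
exists 0; apply/rowP => x; rewrite [RHS]mxE; move: x; apply: sqr_eq0.
have /GK : \sum_x u 0 x = 0.
  by move/eqP: sum_u; rewrite mulf_eq0 (negPf D_neq0) => /eqP.
rewrite energyE mulrA -subr_ge0 -[X in _ - X]mul1r -mulrBl.
rewrite nmulr_rge0 // subr_lt0 -(mulfV (lt0r_neq0 K0)) ltr_pM2l //.
Qed.

(** Otherwise the two lowest eigenvalues lie below [K^-1], and two rows of [P] are constant, which
    contradicts their orthogonality. *)
Lemma alg_connectivity_ge (K : R) : (1 < n)%N -> 0 < K -> poincare G K ->
  K^-1 <= alg_connectivity R G.
Proof.
move=> n1 K0 GK; have [P [D [i0 [i1 [Pu LE ne_i D01 [-> _]]]]]] := alg_connectivityP n1.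
rewrite leNgt; apply/negP => DK.
have const_row i : D i < K^-1 -> exists c : C, row i P = const_mx c.
  move=> DiK; have [LRe LIm] := eigenvector_Re_Im i Pu LE.
  have [a aE] := eigenvector_const K0 GK DiK LRe.
  have [b bE] := eigenvector_const K0 GK DiK LIm.
  exists (Complex a b); apply/rowP => j.
  move/rowP/(_ j): aE; move/rowP/(_ j): bE; rewrite !mxE.
  by case: (P i j) => ? ? /= -> ->.
have [c0 row0] := const_row _ (le_lt_trans D01 DK).
have [c1 row1] := const_row _ DK.
have dot i j : \sum_k P i k * (P j k)^* = (i == j)%:R.
  have := unitarymxP Pu => /matrixP/(_ i j); rewrite !mxE => <-.
  by apply: eq_bigr => k _; rewrite !mxE.
have P0 k : P i0 k = c0 by move/rowP/(_ k): row0; rewrite !mxE.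
have P1 k : P i1 k = c1 by move/rowP/(_ k): row1; rewrite !mxE.
have := dot i0 i1; have := dot i0 i0; have := dot i1 i1.
rewrite !eqxx (negPf ne_i).
under eq_bigr do rewrite P1; under [in X in _ -> X]eq_bigr do rewrite P0.
under [X in _ -> _ -> X = _ -> _]eq_bigr do rewrite P0 P1.
rewrite !sumr_const card_ord /= => c11 c00 c01.
have {}c11 : c1 * c1^* *+ n = 1 := c11.
have {}c00 : c0 * c0^* *+ n = 1 := c00.
have := oner_neq0 C; rewrite -c11 -(mulr_natr (c1 * _)).
have : (c0 * c1^* *+ n) = 0 by [].
move/eqP; rewrite mulrn_eq0 mulf_eq0 conjC_eq0.
case/or3P => [/eqP n0|/eqP c0_0|/eqP c1_0].
- by rewrite n0 in n1.
- by have := oner_neq0 C; rewrite -c00 c0_0 mul0r mul0rn eqxx.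
- by rewrite c1_0 !mul0r eqxx.
Qed.

(** Expand [f] in the eigenbasis. If [D i1 > 0], the all-ones vector, killed by the Laplacian, lies
    along row [i0]; so [f] has no component there, and all other eigenvalues are at least [D i1]. *)
Lemma alg_connectivity_poincare f : (1 < n)%N -> \sum_x f x = 0 ->
  alg_connectivity R G * \sum_x f x ^+ 2 <= energy G f.
Proof.
move=> n1 f0.
have [P [D [i0 [i1 [Pu LE ne_i D01 [-> D1]]]]]] := alg_connectivityP n1.
have [D1_le0|D1_gt0] := leP (D i1) 0.
  apply: le_trans (energy_ge0 G f); rewrite mulr_le0_ge0 // sumr_ge0 // => x _.
  exact: sqr_ge0.
pose u : 'rV[R]_n := \row_x f x; pose c := map_mx toC u *m P^t*.
have PP : P^t* *m P = 1%:M := mulmx1C (unitarymxP Pu).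
pose e : 'rV[C]_n := const_mx 1 *m P^t*.
have eD i : i != i0 -> e 0 i = 0.
  move=> ne_i0; have : e *m diag_mx (\row_i toC (D i)) = 0.
    have -> : e *m diag_mx (\row_i toC (D i)) =
        const_mx 1 *m map_mx toC (laplacian R G) *m P^t*.
      by rewrite LE /e !mulmxA -(mulmxA _ P) (unitarymxP Pu) mulmx1.
    have -> : const_mx 1 *m map_mx toC (laplacian R G) =
        map_mx toC (const_mx 1 *m laplacian R G) :> 'rV_n.
      by rewrite map_mxM map_const_mx rmorph1.
    by rewrite const_mulmx_laplacian map_mx0 mul0mx.
  rewrite mul_mx_diag => /rowP/(_ i); rewrite !mxE => /eqP.
  rewrite mulf_eq0 => /orP[/eqP//|/eqP/complexI Di0].
  by have := D1 i ne_i0; rewrite Di0 leNgt D1_gt0.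
have trC (w : 'rV[C]_n) i : w^t* i 0 = (w 0 i)^* by rewrite !mxE.
have uT x : (map_mx toC u)^t* x 0 = toC (f x).
  by rewrite 3!mxE [u 0 x]mxE; apply/conj_Creal/complex_realP; exists (f x).
have norm_c : c *m c^t* = (\sum_x toC (f x ^+ 2))%:M.
  rewrite /c trmx_mul map_mxM trmxCK !mulmxA -(mulmxA _ _ P) PP mulmx1.
  apply/matrixP => a b; rewrite !ord1 !mxE mulr1n; apply: eq_bigr => x _.
  rewrite uT mxE mxE -rmorphM expr2 //.
have c0 : c 0 i0 = 0.
  have ce : c *m e^t* = 0.
    rewrite /c /e trmx_mul map_mxM trmxCK !mulmxA -(mulmxA _ _ P) PP mulmx1.
    apply/matrixP => a b; rewrite !ord1 !mxE -[RHS](rmorph0 toC) -f0 rmorph_sum /=.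
    by apply: eq_bigr => x _; rewrite !mxE conjC1 mulr1.
  move/matrixP/(_ 0 0): ce; rewrite mxE [RHS]mxE (bigD1 i0) //= big1 => [|i ne_i0]; last first.
    by rewrite trC eD // conjC0 mulr0.
  rewrite addr0 trC => /eqP; rewrite mulf_eq0 conjC_eq0 => /orP[/eqP//|/eqP e0].
  have : e = 0 by apply/rowP => i; rewrite [RHS]mxE; case: (eqVneq i i0) => [->|/eD].
  move/(congr1 (mulmx^~ P)); rewrite /e -mulmxA PP mulmx1 mul0mx.
  by move/rowP/(_ i0)/eqP; rewrite !mxE oner_eq0.
suff : toC (D i1 * \sum_x f x ^+ 2) <= toC (energy G f) by rewrite lecR.
have -> : energy G f = energy G (fun x => u 0 x).
  by congr (energy G _); apply: funext => x; rewrite mxE.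
have -> : toC (energy G (fun x => u 0 x)) =
    \sum_i toC (D i) * (c 0 i * (c 0 i)^*).
  have -> : toC (energy G (fun x => u 0 x)) =
      (c *m diag_mx (\row_i toC (D i)) *m c^t*) 0 0.
    rewrite -form_laplacian rmorph_sum /c trmx_mul map_mxM trmxCK !mulmxA.
    rewrite -(mulmxA (map_mx toC u)) -(mulmxA (map_mx toC u)) -LE -map_mxM mxE.
    by apply: eq_bigr => x _; rewrite rmorphM uT [u 0 x]mxE [X in _ = X * _]mxE.
  rewrite mul_mx_diag mxE; apply: eq_bigr => i _.
  by rewrite trC mxE [(\row__ _) _ _]mxE mulrAC mulrC.
have -> : toC (D i1 * \sum_x f x ^+ 2) = \sum_i toC (D i1) * (c 0 i * (c 0 i)^*).
  rewrite rmorphM rmorph_sum -mulr_sumr; congr (_ * _).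
  move/matrixP/(_ 0 0): norm_c; rewrite mxE [RHS]mxE mulr1n => <-.
  by apply: eq_bigr => i _; rewrite trC.
apply: ler_sum => i _; case: (eqVneq i i0) => [->|ne_i0].
  by rewrite c0 mul0r !mulr0.
by rewrite ler_wpM2r ?mul_conjC_ge0 // lecR D1.
Qed.

End SpectralGap.

(** * Sorted cuts *)

Section Cuts.
Variables (n : nat) (G : sgraph n).
Implicit Types (x y : 'I_n) (S T : {set 'I_n}).

Definition edges_between S T : nat := \sum_(x in S) \sum_(y in T) G x y.

Definition cut S : nat := edges_between S (~: S).

Lemma edges_betweenC S T : edges_between S T = edges_between T S.
Proof.
rewrite /edges_between exchange_big; apply: eq_bigr => x _.
by apply: eq_bigr => y _; rewrite adj_sym.
Qed.

Lemma edges_betweenUr S T T' : [disjoint T & T'] ->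
  edges_between S (T :|: T') = (edges_between S T + edges_between S T')%N.
Proof.
move=> dT; rewrite /edges_between -big_split; apply: eq_bigr => x _ /=.
by rewrite -bigU //=; apply: eq_bigl => y; rewrite !inE.
Qed.

Lemma edges_between_sub S S' T T' : S \subset S' -> T \subset T' ->
  (edges_between S T <= edges_between S' T')%N.
Proof.
move=> SS' TT'; rewrite /edges_between.
rewrite [leqRHS](big_setID S) (finset.setIidPr SS') /=; apply: leq_trans (leq_addr _ _).
apply: leq_sum => x _; rewrite [leqRHS](big_setID T) (finset.setIidPr TT') /=.
exact: leq_addr.
Qed.

Lemma edges_between_diag S : (edges_between S S <= #|S| * #|S|.-1)%N.
Proof.
rewrite /edges_between -sum_nat_const; apply: leq_sum => x xS.
rewrite (big_setD1 x) //= adj_irr add0n.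
rewrite (cardsD1 x S) xS /=.
rewrite -sum1_card; apply: leq_sum => y _; by case: (G x y).
Qed.

Lemma degree_sum d S : regular G d ->
  (#|S| * d)%N = edges_between S [set: 'I_n].
Proof.
move=> reg; rewrite -sum_nat_const; apply: eq_bigr => x _.
rewrite -(reg x) /deg -sum1_card big_mkcond /=.
under [RHS]eq_bigl do rewrite inE.
by apply: eq_bigr => y _; rewrite inE; case: (G x y).
Qed.

Lemma cut0 : cut finset.set0 = 0%N.
Proof. by rewrite /cut /edges_between big_set0. Qed.

Lemma cutC S : cut (~: S) = cut S.
Proof. by rewrite /cut finset.setCK edges_betweenC. Qed.

(* At most [cut S + cut T] edges leave [T :\: S]; all its other edges are inside. *)
Lemma cut_add d S T : regular G d -> S \subset T ->
  (#|T :\: S| * d <= cut S + cut T + #|T :\: S| * #|T :\: S|.-1)%N.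
Proof.
move=> reg ST; set I := T :\: S.
have -> : (#|I| * d)%N =
    (edges_between I S + edges_between I I + edges_between I (~: T))%N.
  rewrite (degree_sum _ reg) -!edges_betweenUr.
  - congr (edges_between I _); apply/setP => x; rewrite !inE.
    by case: (x \in S) => //=; case: (x \in T).
  - rewrite -finset.setI_eq0; apply/eqP/setP => x; rewrite !inE.
    have := fintype.subsetP ST x; case: (x \in S) => //= [->|] //.
    by case: (x \in T).
  - rewrite -finset.setI_eq0; apply/eqP/setP => x; rewrite !inE.
    by case: (x \in S).
have IS : (edges_between I S <= cut S)%N.
  rewrite edges_betweenC; apply: edges_between_sub => //.
  by apply/fintype.subsetP => x; rewrite !inE => /andP[].
have IT : (edges_between I (~: T) <= cut T)%N.
  by apply: edges_between_sub => //; apply/fintype.subsetP => x; rewrite !inE => /andP[].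
have := edges_between_diag I; lia.
Qed.

(** With [S] on both sides every edge is counted from both of its ends. *)
Lemma edges_between_even S : ~~ odd (edges_between S S).
Proof.
have -> : edges_between S S = (\sum_(x in S) \sum_(y in S | (x < y)%N) G x y).*2.
  rewrite -addnn {2}(exchange_big_dep (mem S)) => [|x y _ /andP[]//] /=.
  rewrite -big_split /=; apply: eq_bigr => x xS.
  rewrite (bigID (fun y : 'I_n => (x < y)%N)) /=; congr (_ + _)%N.
  rewrite (eq_bigr (fun y : 'I_n => G y x : nat)) => [|y _]; last by rewrite adj_sym.
  rewrite [LHS]big_mkcond [RHS]big_mkcond /=; apply: eq_bigr => y _.
  case: (ltngtP x y) => [xy|yx|/val_inj ->]; rewrite ?andbF ?andbT //.
    by rewrite xS andbT.
  by rewrite adj_irr if_same.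
by rewrite odd_double.
Qed.

(** The degree sum is the cut plus twice the inner edges. For [d = 2] this gives every nonempty cut
    at least two edges. *)
Lemma odd_cut d S : regular G d -> ~~ odd d -> ~~ odd (cut S).
Proof.
move=> reg d_even; have := degree_sum S reg.
have -> : [set: 'I_n] = S :|: ~: S by rewrite finset.setUCr.
rewrite edges_betweenUr ?finset.disjoints_subset ?finset.setCK // => /(congr1 odd).
rewrite oddM (negPf d_even) andbF oddD (negPf (edges_between_even S)) /=.
by rewrite /cut => <-.
Qed.

Lemma cut_gt0 S x y : Defs.connected G -> x \in S -> y \notin S -> (0 < cut S)%N.
Proof.
move=> /forall_inP/(_ x); rewrite inE => /(_ isT) /forall_inP/(_ y).
rewrite inE => /(_ isT) /connectP[p]; elim: p x => [|z p IH] x /=.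
  by move=> _ -> ->.
rewrite !inE /= => /andP[Gxz zp] yE xS yS.
have [zS|zS] := boolP (z \in S); first exact: (IH z).
rewrite /cut /edges_between (bigD1 x) //= (bigD1 z) ?inE //= Gxz.
by rewrite -!addnA addn_gt0.
Qed.

End Cuts.

(** * Resistance along the sorted vertices and the Schur test *)

Section SortedCuts.
Variable R : realType.
Implicit Types (F g e : nat -> R) (n a b k l : nat).

Lemma sorting_perm n (f : 'I_n -> R) : exists s : {perm 'I_n},
  forall i j : 'I_n, (i <= j)%N -> f (s i) <= f (s j).
Proof.
pose t := sort (fun x y => f x <= f y) (enum 'I_n).
have size_t : size t = n by rewrite size_sort size_enum_ord.
have t_uniq : uniq t by rewrite sort_uniq enum_uniq.
have inj : injective (fun i : 'I_n => nth i t i).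
  move=> i j /eqP; rewrite (set_nth_default i) ?size_t //.
  by rewrite nth_uniq ?size_t // => /eqP/val_inj.
exists (perm inj) => i j ij; rewrite !permE (set_nth_default i) ?size_t //.
have le_tot : total (fun x y : 'I_n => f x <= f y) by move=> x y; exact: le_total.
have le_tr : transitive (fun x y : 'I_n => f x <= f y) by move=> x y z; exact: le_trans.
by apply: (sorted_leq_nth le_tr _ i (sort_sorted le_tot _)); rewrite ?inE ?size_t //.
Qed.

(** The increments have one sign, so the cross terms of the square are nonnegative. This is why the
    vertices are sorted: the square along an edge pays for the squared increments at all the cuts
    that it crosses. *)
Lemma sqr_increment_ge F a b : (a <= b)%N ->
  {in [pred k | (k <= b)%N] &, {homo F : x y / (x <= y)%N >-> x <= y}} ->
  \sum_(a.+1 <= k < b.+1) (F k - F k.-1) ^+ 2 <= (F b - F a) ^+ 2.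
Proof.
elim: b => [|b IH]; first by rewrite leqn0 => /eqP -> _; rewrite big_geq // sqr_ge0.
rewrite leq_eqVlt => /predU1P[-> _|]; first by rewrite big_geq // sqr_ge0.
rewrite ltnS => ab Fmono; rewrite big_nat_recr //=.
have Fab : F a <= F b by apply: Fmono; rewrite ?inE //; lia.
have Fb : F b <= F b.+1 by apply: Fmono; rewrite ?inE //; lia.
have := IH ab; set S := \sum_(_ <= _ < _) _; move=> {}IH.
have {}IH : S <= (F b - F a) ^+ 2.
  by apply: IH => x y; rewrite !inE => xb yb; apply: Fmono; rewrite inE ltnW.
by nra.
Qed.

Lemma cauchy_increment F e a b : (a <= b)%N ->
  (forall k, (a < k <= b)%N -> 0 < e k) ->
  (F b - F a) ^+ 2 <= (\sum_(a.+1 <= k < b.+1) (e k)^-1) *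
    (\sum_(a.+1 <= k < b.+1) e k * (F k - F k.-1) ^+ 2).
Proof.
elim: b => [|b IH].
  by rewrite leqn0 => /eqP -> _; rewrite !big_geq // mul0r subrr expr0n.
rewrite leq_eqVlt => /predU1P[-> _|].
  by rewrite !big_geq // mul0r subrr expr0n.
rewrite ltnS => ab e0; do 2 rewrite (@big_nat_recr _ _ _ b.+1 a.+1) //=.
have {IH} : (F b - F a) ^+ 2 <= (\sum_(a.+1 <= k < b.+1) (e k)^-1) *
    (\sum_(a.+1 <= k < b.+1) e k * (F k - F k.-1) ^+ 2).
  by apply: IH => // k kab; apply: e0; lia.
have eb : 0 < e b.+1 by apply: e0; lia.
have ebV : 0 < (e b.+1)^-1 by rewrite invr_gt0.
have eeV : e b.+1 * (e b.+1)^-1 = 1 by rewrite mulfV ?gt_eqF.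
have : 0 <= \sum_(a.+1 <= k < b.+1) (e k)^-1.
  rewrite big_nat sumr_ge0 // => k kab; rewrite invr_ge0 ltW // e0 //; lia.
have : 0 <= \sum_(a.+1 <= k < b.+1) e k * (F k - F k.-1) ^+ 2.
  rewrite big_nat sumr_ge0 // => k kab; rewrite mulr_ge0 ?sqr_ge0 // ltW // e0 //; lia.
have -> : F b.+1 - F a = (F b - F a) + (F b.+1 - F b) by ring.
move: (F b - F a) (F b.+1 - F b) (e b.+1) (e b.+1)^-1 eb ebV eeV.
move: (\sum_(_ <= _ < _) _) (\sum_(_ <= _ < _) _).
move=> P Q A x u v u0 v0 uv Q0 P0 AQP.
have P_0 : 0 <= P * (u * x ^+ 2) := mulr_ge0 P0 (mulr_ge0 (ltW u0) (sqr_ge0 x)).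
have Q_0 : 0 <= v * Q := mulr_ge0 (ltW v0) Q0.
(* Arithmetic-geometric mean for the cross term, with [A ^+ 2 <= P * Q] and [u * v = 1]. *)
have : A * x *+ 2 <= P * (u * x ^+ 2) + v * Q.
  apply: le_trans (ler_norm _) _; rewrite -ler_sqr ?nnegrE ?addr_ge0 //.
  rewrite real_normK ?num_real //.
  have -> : (A * x *+ 2) ^+ 2 = 4 * x ^+ 2 * A ^+ 2 by ring.
  apply: (@le_trans _ _ (4 * x ^+ 2 * (P * Q))).
    by rewrite ler_wpM2l // mulr_ge0 ?sqr_ge0.
  rewrite -subr_ge0; apply: le_trans (sqr_ge0 (P * (u * x ^+ 2) - v * Q)) _.
  suff -> : (P * (u * x ^+ 2) - v * Q) ^+ 2 =
    (P * (u * x ^+ 2) + v * Q) ^+ 2 - 4 * x ^+ 2 * (P * Q) by [].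
  have -> : P * Q = u * v * (P * Q) by rewrite uv mul1r.
  ring.
have -> : (P + v) * (Q + u * x ^+ 2) = P * Q + (P * (u * x ^+ 2) + v * Q) + u * v * x ^+ 2.
  by ring.
rewrite uv mul1r sqrrD => Ax; rewrite lerD // lerD //.
Qed.

(** Cut [k] runs between positions [k - 1] and [k]. *)
Definition separates k (i j : nat) : bool := (i < k)%N (+) (j < k)%N.

Lemma separatesC k i j : separates k i j = separates k j i.
Proof. by rewrite /separates addbC. Qed.

Lemma sum_separates n i j (a : nat -> R) : (i <= j < n)%N ->
  \sum_(1 <= k < n) (separates k i j)%:R * a k = \sum_(i.+1 <= k < j.+1) a k.
Proof.
move=> /andP[ij jn].
rewrite (@big_cat_nat _ _ _ i.+1) //=; last by lia.
rewrite (@big_cat_nat _ _ _ j.+1 i.+1) //=.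
rewrite big_nat big1 ?add0r => [|k ki]; last first.
  have -> : separates k i j = false by rewrite /separates; lia.
  by rewrite mul0r.
rewrite [X in _ + X]big_nat [X in _ + X]big1 ?addr0 => [|k ki]; last first.
  have -> : separates k i j = false by rewrite /separates; lia.
  by rewrite mul0r.
rewrite big_nat [RHS]big_nat; apply: eq_bigr => k ki.
have -> : separates k i j = true by rewrite /separates; lia.
by rewrite mul1r.
Qed.

(** One position lies before both cuts and the other beyond both; the factor 2 comes from ordered
    pairs. *)
Lemma count_separates n k l : (k <= n)%N -> (l <= n)%N ->
  \sum_(i < n) \sum_(j < n) (separates k i j && separates l i j)%:R =
    (minn k l * (n - maxn k l))%:R *+ 2 :> R.
Proof.
wlog kl : k l / (k <= l)%N => [hw kn ln|].
  case/orP: (leq_total k l) => kl; first exact: hw.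
  rewrite minnC maxnC -hw //; apply: eq_bigr => i _; apply: eq_bigr => j _.
  by rewrite andbC.
move=> kn ln; rewrite (minn_idPl kl) (maxn_idPr kl).
have sumlt m : (m <= n)%N -> \sum_(i < n) (i < m)%N%:R = m%:R :> R.
  move=> mn; rewrite -natr_sum; congr (_%:R); rewrite -[RHS](card_ord m) -sum1_card.
  rewrite (big_ord_widen _ (fun=> 1%N) mn) [RHS]big_mkcond /=.
  by apply: eq_bigr => i _; case: ltnP.
have sumge m : (m <= n)%N -> \sum_(i < n) (m <= i)%N%:R = (n - m)%:R :> R.
  move=> mn; rewrite natrB // -(sumlt m mn).
  have -> : n%:R = \sum_(i < n) (1 : R) by rewrite sumr_const card_ord.
  rewrite -sumrB; apply: eq_bigr => i _.
  by rewrite ltnNge; case: leqP; rewrite ?subr0 ?subrr.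
transitivity (\sum_(i < n) \sum_(j < n)
    ((i < k)%N%:R * (l <= j)%N%:R + (l <= i)%N%:R * (j < k)%N%:R) : R).
  apply: eq_bigr => i _; apply: eq_bigr => j _; rewrite -!natrM !mulnb -natrD.
  congr (_%:R); rewrite /separates.
  by case: (ltnP i k); case: (leqP l i); case: (ltnP j k); case: (leqP l j); lia.
under eq_bigr do rewrite big_split /= -!mulr_sumr (sumge l) // (sumlt k) //.
by rewrite big_split /= -!mulr_suml (sumge l) // (sumlt k) // natrM mulrC mulr2n mulrC.
Qed.

Definition initial n (s : {perm 'I_n}) k : {set 'I_n} :=
  [set x | ((s^-1)%g x < k)%N]%SET.

Lemma in_initial n (s : {perm 'I_n}) k (i : 'I_n) :
  (s i \in initial s k) = (i < k)%N.
Proof. by rewrite inE permK. Qed.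

Lemma initial_sub n (s : {perm 'I_n}) k l : (k <= l)%N ->
  initial s k \subset initial s l.
Proof.
by move=> kl; apply/fintype.subsetP => x; rewrite !inE => /leq_trans; apply.
Qed.

Lemma card_initial n (s : {perm 'I_n}) k : (k <= n)%N -> #|initial s k| = k.
Proof.
move=> kn; rewrite -sum1_card big_mkcond (reindex_inj (@perm_inj _ s)) /=.
under eq_bigr do rewrite in_initial.
by rewrite -big_mkcond -(big_ord_widen _ (fun=> 1%N) kn) sum1_card card_ord.
Qed.

Lemma cut_sum n (G : sgraph n) (s : {perm 'I_n}) k :
  (cut G (initial s k))%:R *+ 2 =
    \sum_(i < n) \sum_(j < n) (G (s i) (s j))%:R * (separates k i j)%:R :> R.
Proof.
have cutE : (cut G (initial s k))%:R = \sum_(i < n) \sum_(j < n)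
    (G (s i) (s j))%:R * ((i < k)%N && ~~ (j < k)%N)%:R :> R.
  rewrite /cut /edges_between big_mkcond (reindex_inj (@perm_inj _ s)) natr_sum /=.
  apply: eq_bigr => i _; rewrite in_initial.
  case: ifP => ik; last by rewrite big1 // => j _; rewrite mulr0.
  rewrite big_mkcond (reindex_inj (@perm_inj _ s)) natr_sum /=.
  apply: eq_bigr => j _; rewrite finset.in_setC in_initial.
  by case: ltnP => _ /=; rewrite ?mulr0 ?mulr1.
rewrite mulr2n {2}cutE exchange_big cutE -big_split /=.
apply: eq_bigr => i _; rewrite -big_split /=; apply: eq_bigr => j _.
rewrite (adj_sym G (s j)) -mulrDr /separates.
by congr (_ * _); case: (ltnP i k); case: (ltnP j k) => _ _ /=; rewrite ?addr0 ?add0r.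
Qed.

Lemma sum_pairs_sqr n (f : 'I_n -> R) :
  \sum_x \sum_y (f x - f y) ^+ 2 =
    (n%:R * (\sum_x f x ^+ 2) - (\sum_x f x) ^+ 2) *+ 2.
Proof.
transitivity (\sum_(x < n) (f x ^+ 2 *+ n + \sum_y f y ^+ 2 -
    f x * (\sum_y f y *+ 2))).
  apply: eq_bigr => x _; rewrite -[X in _ *+ X](card_ord n) -sumr_const.
  rewrite mulr_sumr -big_split -sumrB /=.
  by apply: eq_bigr => y _; ring.
rewrite sumrB big_split /= sumr_const card_ord -mulr_suml !sumrMnl; ring.
Qed.

Lemma reindex_perm_sum n (s : {perm 'I_n}) (f : 'I_n -> R) :
  \sum_x f x = \sum_x f (s x).
Proof. exact: (reindex_inj (@perm_inj _ s)). Qed.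

(* Cauchy-Schwarz along the sorted path bounds [(F j - F i) ^+ 2] by the
   resistance between positions [i] and [j] times the energy crossed; the pairs
   whose path uses both cuts [k] and [l] number [min(k, l) * (n - max(k, l))]. *)
Lemma poincare_cuts n (G : sgraph n) (M : R) : Defs.connected G ->
  (forall (s : {perm 'I_n}) k, (0 < k < n)%N ->
    \sum_(1 <= l < n) (minn k l * (n - maxn k l))%:R / (cut G (initial s l))%:R <= M) ->
  poincare G (M / n%:R).
Proof.
move=> Gconn Mle f f0.
have [n0|n_gt0] := posnP n.
  rewrite big1 => [|[i ilt] _]; last by exfalso; rewrite n0 in ilt.
  by rewrite {1}n0 invr0 mulr0 mul0r.
have [s s_mono] := sorting_perm f.
(* [F] extends the sorted values to [nat] by 0, so monotonicity is claimed below [n] only. *)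
pose F k := oapp (f \o s) 0 (insub k).
have FE (i : 'I_n) : F i = f (s i) by rewrite /F valK.
have F_mono : {in [pred k | (k < n)%N] &, {homo F : x y / (x <= y)%N >-> x <= y}}.
  move=> i j; rewrite !inE => i_n j_n ij.
  by have := s_mono (Ordinal i_n) (Ordinal j_n) ij; rewrite -!FE.
pose e k : R := (cut G (initial s k))%:R.
have e_gt0 k : (0 < k < n)%N -> 0 < e k.
  move=> /andP[k0 kn]; rewrite ltr0n.
  apply: (@cut_gt0 _ _ _ (s (Ordinal n_gt0)) (s (Ordinal kn))) => //;
  by rewrite in_initial //= -leqNgt.
pose E k := e k * (F k - F k.-1) ^+ 2.
have E_ge0 k : 0 <= E k by rewrite mulr_ge0 ?sqr_ge0 // ler0n.
have energy_ge : \sum_(1 <= k < n) E k <= energy G f.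
  rewrite /energy ler_pdivlMr // mulr_natr -sumrMnl /E /e.
  under eq_bigr do rewrite -mulrnAl cut_sum.
  under eq_bigr => k _ do rewrite mulr_suml.
  rewrite exchange_big /= [leRHS](reindex_inj (@perm_inj _ s)) /=.
  apply: ler_sum => i _; under eq_bigr => k _ do rewrite mulr_suml.
  rewrite exchange_big /= [leRHS](reindex_inj (@perm_inj _ s)) /=.
  apply: ler_sum => j _; under eq_bigr do rewrite -mulrA.
  rewrite -mulr_sumr ler_wpM2l // -!FE.
  wlog ij : i j / (i <= j)%N => [hw|].
    case/orP: (leq_total i j) => [/hw//|/hw]; rewrite -(sqrrN (F i - F j)) opprB.
    by under eq_bigr do rewrite separatesC.
  rewrite sum_separates ?ij ?ltn_ord // -(sqrrN (F i - F j)) opprB.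
  apply: sqr_increment_ge => // x y; rewrite !inE => xj yj; apply: F_mono;
  by rewrite inE (leq_ltn_trans _ (ltn_ord j)).
suff : n%:R * \sum_x f x ^+ 2 <= M * energy G f.
  by rewrite mulrAC ler_pdivlMr ?ltr0n // mulrC.
(* For [n > 1] the hypothesis at [k = 1] supplies the sign of [M]; a single vertex is treated
   apart. *)
have Mpos : (1 < n)%N -> 0 <= M.
  move=> n1; apply: le_trans (Mle s 1%N _); last by rewrite n1.
  by rewrite sumr_ge0 // => l _; rewrite divr_ge0.
have [n1|n_le1] := ltnP 1 n; last first.
  have n1 : n = 1%N by lia.
  rewrite /energy; move: f f0 {s s_mono F FE F_mono e e_gt0 E E_ge0 energy_ge Mle Gconn Mpos}.
  move: G; rewrite n1 => H f; rewrite !big_ord1 => ->.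
  by rewrite subrr !expr0n !mulr0 mul0r mulr0.
apply: le_trans (ler_wpM2l (Mpos n1) energy_ge).
rewrite -(ler_pMn2r (ltn0Sn 1)).
have -> : n%:R * (\sum_x f x ^+ 2) *+ 2 = \sum_(i < n) \sum_(j < n) (F i - F j) ^+ 2.
  transitivity (\sum_(i < n) \sum_(j < n) (f (s i) - f (s j)) ^+ 2); last first.
    by apply: eq_bigr => i _; apply: eq_bigr => j _; rewrite !FE.
  rewrite sum_pairs_sqr -(reindex_perm_sum s f) -(reindex_perm_sum s (fun x => f x ^+ 2)).
  by rewrite f0 expr0n subr0.
apply: (@le_trans _ _ (\sum_(i < n) \sum_(j < n)
   \sum_(1 <= k < n) \sum_(1 <= l < n)
     (separates k i j && separates l i j)%:R * (E k / e l))).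
  apply: ler_sum => i _; apply: ler_sum => j _.
  wlog ij : i j / (i <= j)%N => [hw|].
    case/orP: (leq_total i j) => [/hw//|/hw]; rewrite -(sqrrN (F i - F j)) opprB.
    move/le_trans; apply; apply: ler_sum => k _; apply: ler_sum => l _.
    by rewrite separatesC (separatesC l).
  rewrite -(sqrrN (F i - F j)) opprB.
  apply: le_trans (@cauchy_increment F e i j ij _) _.
    by move=> k kij; apply: e_gt0; have := ltn_ord j; lia.
  rewrite -!(@sum_separates n) ?ij ?ltn_ord // mulrC mulr_suml.
  apply: ler_sum => k _; rewrite mulr_sumr; apply: ler_sum => l _.
  by rewrite -mulnb natrM mulrACA.
rewrite exchange_big /=.
have -> : \sum_(j < n) \sum_(i < n) \sum_(1 <= k < n) \sum_(1 <= l < n)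
     (separates k i j && separates l i j)%:R * (E k / e l) =
   \sum_(1 <= k < n) E k * ((\sum_(1 <= l < n)
      (minn k l * (n - maxn k l))%:R / e l) *+ 2).
  under eq_bigr => j _ do rewrite exchange_big /=.
  rewrite exchange_big /= big_nat [RHS]big_nat; apply: eq_bigr => k kn.
  under eq_bigr => j _ do rewrite exchange_big /=.
  rewrite exchange_big /= -sumrMnl mulr_sumr big_nat [RHS]big_nat.
  apply: eq_bigr => l ln; rewrite exchange_big /=.
  under eq_bigr => i _ do rewrite -mulr_suml.
  rewrite -mulr_suml count_separates; [|lia|lia].
  by move: (E k) (e l)^-1 => p q; ring.
rewrite -mulrnAr -mulr_natr mulrA (mulrC M) -mulrA mulr_suml.
rewrite big_nat [leRHS]big_nat; apply: ler_sum => k kn.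
rewrite ler_wpM2l // -mulr_natr ler_wpM2r // Mle //; lia.
Qed.

End SortedCuts.

(** * Contributions of the small and of the large cuts *)

Section CutSums.
Variable R : realType.
Implicit Types (n k l w d a : nat) (S : pred nat) (e : nat -> nat).

(** This is [n] times the Green function of the path with [n] edges and fixed ends. *)
Definition tent n k l : R := (minn k l * (n - maxn k l))%:R.

Lemma tent_ge0 n k l : 0 <= tent n k l.
Proof. exact: ler0n. Qed.

Lemma tent_left n k l : (l <= k <= n)%N -> tent n k l = l%:R * (n%:R - k%:R).
Proof.
move=> /andP[lk kn]; rewrite /tent (minn_idPr lk) (maxn_idPl lk).
by rewrite natrM natrB.
Qed.

Lemma tent_right n k l : (k <= l <= n)%N -> tent n k l = k%:R * (n%:R - l%:R).
Proof.
move=> /andP[kl ln]; rewrite /tent (minn_idPl kl) (maxn_idPr kl).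
by rewrite natrM natrB.
Qed.

Lemma tent_max n k l : (k <= n)%N -> (l <= n)%N -> tent n k l <= n%:R ^+ 2 / 4.
Proof.
move=> kn ln; wlog kl : k l kn ln / (k <= l)%N => [hw|].
  case/orP: (leq_total k l) => kl; first exact: hw.
  by rewrite /tent minnC maxnC; apply: hw.
rewrite tent_right ?kl // ler_pdivlMr //.
have : k%:R <= l%:R :> R by rewrite ler_nat.
have : l%:R <= n%:R :> R by rewrite ler_nat.
have : 0 <= k%:R :> R by [].
move: k%:R l%:R n%:R => x y z x0 yz xy.
have := mulr_ge0 x0 (_ : 0 <= y - x); rewrite subr_ge0 => /(_ xy).
by have := sqr_ge0 (z - 2 * x); nra.
Qed.

(* The trapezoid rule underestimates the integral of the concave function
   [tent n k], so sampling it at points at least [w] apart, the two endpoints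
   included, gives at most [1/w] times that integral. *)
Lemma tent_sum S n w k : (k <= n)%N -> S 0%N -> S n ->
  (forall l l', (l < l' <= n)%N -> S l -> S l' -> (l + w <= l')%N) ->
  w%:R * \sum_(1 <= l < n) (S l)%:R * tent n k l <=
    n%:R * k%:R * (n%:R - k%:R) / 2.
Proof.
move=> kn S0 Sn gap.
have [n0|n_gt0] := posnP n.
  by rewrite n0 big_geq // !mul0r mulr0.
(* [T x] is twice the integral of the tent from 0 to [x]. *)
pose T x : R := if (x <= k)%N then (n%:R - k%:R) * x%:R ^+ 2
  else n%:R * k%:R * (n%:R - k%:R) - k%:R * (n%:R - x%:R) ^+ 2.
pose A x := \sum_(0 <= l < x.+1) (S l)%:R * tent n k l.
have knn : (k <= n <= n)%N by rewrite kn leqnn.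
(* Twice the trapezoid over an interval: exact if the interval does not contain the corner [k] in
   its interior, too small by concavity otherwise. *)
have chord y y' : (y <= y' <= n)%N ->
    (y'%:R - y%:R) * (tent n k y + tent n k y') <= T y' - T y.
  move=> /andP[yy' y'n]; have yn := leq_trans yy' y'n.
  have yy'r : y%:R <= y'%:R :> R by rewrite ler_nat.
  rewrite /T; case: (leqP y' k) => y'k.
    rewrite (leq_trans yy' y'k) !tent_left ?kn ?y'k ?(leq_trans yy' y'k) //.
    rewrite -subr_ge0; set z := (X in 0 <= X); suff -> : z = 0 by [].
    by rewrite /z; ring.
  case: (leqP y k) => yk.
    rewrite tent_left ?yk ?kn // tent_right ?(ltnW y'k) //.
    rewrite -subr_ge0; set z := (X in 0 <= X).
    suff -> : z = n%:R * ((k%:R - y%:R) * (y'%:R - k%:R)).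
      rewrite !mulr_ge0 // subr_ge0 ler_nat //; exact: ltnW.
    by rewrite /z; ring.
  rewrite !tent_right ?(ltnW yk) ?(ltnW y'k) //.
  rewrite -subr_ge0; set z := (X in 0 <= X); suff -> : z = 0 by [].
  by rewrite /z; ring.
(* Here [y] is the last sample point up to [x]. The end value at 0 vanishes, so the doubled sum
   minus the value at [y] is the sum of the trapezoids up to [y]. *)
have claim x : (x <= n)%N -> exists y, [/\ (y <= x)%N, S y, S x -> y = x &
    w%:R * (A x *+ 2 - tent n k y) <= T y].
  elim: x => [_|x IH xn].
    exists 0%N; split => //; rewrite /A big_nat1 tent_left ?kn //.
    by rewrite /T leq0n mul0r mulr0 mul0rn subrr mulr0 expr0n mulr0.
  have [y [yx Sy _ Ay]] := IH (ltnW xn).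
  case: (boolP (S x.+1)) => [Sx|/negPf Sx]; last first.
    exists y; split; rewrite ?(leqW yx) ?Sx //.
    by rewrite /A big_nat_recr //= Sx mul0r addr0.
  exists x.+1; split => //.
  have -> : A x.+1 = A x + tent n k x.+1 by rewrite /A big_nat_recr //= Sx mul1r.
  have yw : (y + w <= x.+1)%N by apply: gap => //; rewrite ltnS yx.
  have := chord y x.+1; rewrite (leqW yx) xn => /(_ isT).
  have : w%:R * (tent n k y + tent n k x.+1) <=
         (x.+1%:R - y%:R) * (tent n k y + tent n k x.+1).
    rewrite ler_wpM2r ?addr_ge0 ?tent_ge0 // lerBrDl -natrD ler_nat //.
  move: Ay; move: (tent n k y) (tent n k x.+1) (T y) (T x.+1) (A x) => *; lra.
have [y [_ _ /(_ Sn) -> AT]] := claim n (leqnn n).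
move: AT.
have -> : A n = \sum_(1 <= l < n) (S l)%:R * tent n k l.
  rewrite /A big_nat_recr //= big_ltn // (@tent_left n k 0) ?kn //.
  by rewrite (tent_right knn) subrr mul0r !mulr0 add0r addr0.
rewrite (tent_right knn) subrr mulr0 subr0 mulrnAr /T => AT.
rewrite ler_pdivlMr // [leLHS]mulr_natr; apply: le_trans AT _.
case: leqP => [nk|_]; last by rewrite subrr expr0n mulr0 subr0.
have -> : k = n by lia.
by rewrite subrr mul0r mulr0.
Qed.

(** The area under the tent is largest at [k = n / 2]; this maximum is the origin of the constant
    1/8. *)
Lemma tent_sum_le n w k (S : pred nat) : (k <= n)%N -> (0 < w)%N -> S 0%N -> S n ->
  (forall l l', (l < l' <= n)%N -> S l -> S l' -> (l + w <= l')%N) ->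
  \sum_(1 <= l < n) (S l)%:R * tent n k l <= n%:R ^+ 3 / (8 * w%:R).
Proof.
move=> kn w0 S0 Sn gap; have := tent_sum kn S0 Sn gap.
set s := \sum_(_ <= _ < _) _.
have w0' : 0 < w%:R :> R by rewrite ltr0n.
move=> tle; rewrite ler_pdivlMr ?mulr_gt0 //.
have -> : s * (8 * w%:R) = 8 * (w%:R * s) by ring.
have : n%:R * k%:R * (n%:R - k%:R) / 2 <= n%:R ^+ 3 / 8 :> R.
  rewrite -subr_ge0.
  have -> : n%:R ^+ 3 / 8 - n%:R * k%:R * (n%:R - k%:R) / 2 =
    n%:R * (n%:R - k%:R *+ 2) ^+ 2 / 8 :> R by field.
  by rewrite divr_ge0 // mulr_ge0 ?sqr_ge0.
move: tle; move: (w%:R * s) => {}s; set t := _ / 2; set u := n%:R ^+ 3; lra.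
Qed.

(** Terms with [j < J] are at most 1 and the others at most [1 / J]. With [J] fixed and large, the
    sum is o(w). *)
Lemma harmonic_le J w : (0 < J)%N ->
  \sum_(1 <= j < w) (j%:R)^-1 <= J%:R + w%:R / J%:R :> R.
Proof.
move=> J0; apply: (@le_trans _ _ (\sum_(1 <= j < w) ((j < J)%N%:R + J%:R^-1))).
  rewrite big_nat [leRHS]big_nat; apply: ler_sum => j /andP[j0 _].
  case: ltnP => jJ /=.
    rewrite -[leLHS]addr0 lerD ?invr_ge0 // invf_le1 ?ltr0n // ler1n //.
  by rewrite add0r lef_pV2 ?posrE ?ltr0n // ler_nat.
rewrite big_split /= lerD //.
  rewrite -natr_sum ler_nat; case: w => [|w]; first by rewrite big_geq.
  apply: (@leq_trans (minn J w)); last exact: geq_minl.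
  elim: w => [|w IH]; first by rewrite big_geq.
  by rewrite big_nat_recr //=; move: IH; case: (ltnP w.+1 J) => /=; lia.
rewrite sumr_const_nat -[leLHS]mulr_natl ler_wpM2r ?invr_ge0 // ler_nat; lia.
Qed.

(** As cuts at distance [j] have at least [j * (d.+1 - j)] edges together, this sum with [w = d.+1]
    controls the resistance of a block of cuts on either side of its smallest one. *)
Definition block_sum w : R := \sum_(1 <= j < w) ((j * (w - j))%:R)^-1.

(** Partial fractions turn the sum into [2 / w] times a harmonic sum. *)
Lemma block_sum_small (delta : R) : 0 < delta ->
  exists D, forall w, (D <= w)%N -> block_sum w <= delta.
Proof.
move=> delta0.
have large (x : R) : exists m, (0 < m)%N /\ x <= m%:R.
  exists (Num.truncn `|x|).+1; split=> //.
  by apply: le_trans (ler_norm x) _; apply/ltW/truncnS_gt.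
have [J [J0 Jdelta]] := large (4 / delta).
have [D [D0 Ddelta]] := large (4 * J%:R / delta).
exists D => w Dw; have w0 : (0 < w)%N by exact: leq_trans Dw.
have w0' : 0 < w%:R :> R by rewrite ltr0n.
have -> : block_sum w = 2 / w%:R * \sum_(1 <= j < w) (j%:R)^-1.
  rewrite mulrAC -mulrA [in RHS]mulr_natl mulr2n.
  rewrite -{2}(mulrC (w%:R)^-1) {2}big_nat_rev /=.
  rewrite mulrC -mulrDr -big_split mulr_sumr /block_sum big_nat [RHS]big_nat.
  apply: eq_bigr => j /andP[j0 jw] /=.
  rewrite add1n subSS natrM natrB ?(ltnW jw) //.
  have jne : j%:R != 0 :> R by rewrite pnatr_eq0 -lt0n.
  have wjne : w%:R - j%:R != 0 :> R.
    by rewrite -natrB ?(ltnW jw) // pnatr_eq0 -lt0n subn_gt0.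
  by field; rewrite jne wjne gt_eqF.
have J0' : 0 < J%:R :> R by rewrite ltr0n.
apply: (@le_trans _ _ (2 / w%:R * (J%:R + w%:R / J%:R))).
  by rewrite ler_wpM2l ?divr_ge0 // harmonic_le.
have -> : 2 / w%:R * (J%:R + w%:R / J%:R) = 2 * J%:R / w%:R + 2 / J%:R :> R.
  by field; rewrite !gt_eqF.
have : 2 / J%:R <= delta / 2.
  rewrite ler_pdivrMr //; move: Jdelta; rewrite ler_pdivrMr //; lra.
have : 2 * J%:R / w%:R <= delta / 2.
  rewrite ler_pdivrMr //; have : 4 * J%:R / delta <= w%:R.
    by apply: le_trans Ddelta _; rewrite ler_nat.
  rewrite ler_pdivrMr //; lra.
lra.
Qed.

Section WideGaps.
Variables (n d : nat) (e : nat -> nat).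
Hypothesis d_gt0 : (0 < d)%N.
Hypothesis e_add : forall k l, (k < l <= n)%N ->
  ((l - k) * (d.+1 - (l - k)) <= e k + e l)%N.

Let small l := (e l * 2 < d)%N.

(** For [1 <= j <= d] the product [j * (d.+1 - j)] is at least [d], its value at both ends of this
    range, whereas two small cuts have fewer than [d] edges together. *)
Lemma small_gap l l' : (l < l' <= n)%N -> small l -> small l' -> (l + d.+1 <= l')%N.
Proof.
move=> ll'; have := e_add ll'; rewrite /small => el sl sl'.
rewrite leqNgt; apply/negP => l'd.
have : (d <= (l' - l) * (d.+1 - (l' - l)))%N by nia.
lia.
Qed.

(* Every cut of a block of [d.+1] consecutive ones is compared with the smallest
   cut of that block. *)
Lemma block_bound a :
  \sum_(a <= l < a + d.+1) ((l < n)%N && ~~ small l)%:R / (e l)%:R <=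
    2 / d%:R + 4 * block_sum d.+1 :> R.
Proof.
have d0 : 0 < d%:R :> R by rewrite ltr0n.
have block_ge0 : 0 <= block_sum d.+1 by rewrite sumr_ge0.
(* If [m] is the smallest cut of the block and [l] is at distance [j] from it, then
   [2 * e l >= e l + e m >= j * (d.+1 - j)], that is, [1 / e l <= phi j]. *)
pose phi j : R := 2 / (j * (d.+1 - j))%:R.
have phi_ge0 j : 0 <= phi j by rewrite divr_ge0.
have phi_sum m : (m <= d)%N -> \sum_(0 <= i < m) phi i.+1 <= 2 * block_sum d.+1.
  move=> md; rewrite /block_sum mulr_sumr big_add1 /=.
  by rewrite [leRHS](@big_cat_nat _ _ _ m) //= lerDl sumr_ge0.
have [an|na] := ltnP a n; last first.
  rewrite big_nat big1 ?addr_ge0 ?divr_ge0 ?mulr_ge0 // => l /andP[al _].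
  by rewrite ltnNge (leq_trans na al) mul0r.
pose in_range (i : 'I_d.+1) := (a + i < n)%N.
have in_range0 : in_range ord0 by rewrite /in_range addn0.
case: (arg_minnP (fun i : 'I_d.+1 => e (a + i)%N) in_range0) => i0 i0n e_min.
pose m := (a + i0)%N.
have ltd := ltn_ord i0.
have e_min' l : (a <= l < a + d.+1)%N -> (l < n)%N -> (e m <= e l)%N.
  move=> /andP[al la] ln; have lt_l : (l - a < d.+1)%N by lia.
  have := e_min (Ordinal lt_l); rewrite /in_range /= subnKC //.
  by apply.
have term_le l : (a <= l < a + d.+1)%N -> l != m ->
    ((l < n)%N && ~~ small l)%:R / (e l)%:R <= phi (maxn l m - minn l m)%N.
  move=> la lm; case: ltnP => ln /=; last by rewrite mul0r.
  case: (boolP (small l)) => sl /=; first by rewrite mul0r.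
  have el0 : (0 < e l)%N by move: sl; rewrite /small; lia.
  have eml := e_min' l la ln.
  set j := (maxn l m - minn l m)%N.
  have j1 : (0 < j < d.+1)%N by rewrite /j /m; move: lm la; rewrite /m; lia.
  have ej : (j * (d.+1 - j) <= e l * 2)%N.
    have [lm'|ml] := ltnP l m.
      have := @e_add l m; rewrite lm' (ltnW i0n) => /(_ isT).
      by rewrite /j (minn_idPl (ltnW lm')) (maxn_idPr (ltnW lm')); lia.
    have := @e_add m l; rewrite ltn_neqAle eq_sym lm ml (ltnW ln) => /(_ isT).
    by rewrite /j (minn_idPr ml) (maxn_idPl ml); lia.
  rewrite /phi ler_pdivrMr ?ltr0n // mulrAC ler_pdivlMr; last first.
    by rewrite ltr0n; nia.
  by rewrite mul1r -natrM ler_nat; lia.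
rewrite (@big_cat_nat _ _ _ m) ?leq_addr //=; last by rewrite /m; lia.
rewrite [X in _ + X]big_ltn; last by rewrite /m; lia.
have left_le : \sum_(a <= l < m) ((l < n)%N && ~~ small l)%:R / (e l)%:R <=
    2 * block_sum d.+1.
  apply: le_trans (phi_sum i0 _); last by lia.
  rewrite big_nat_rev /= -{1}(add0n a) /m (addnC a i0) big_addn addnK.
  rewrite big_nat [leRHS]big_nat; apply: ler_sum => i /andP[_ ii0].
  have -> : (0 + a + (i0 + a) - (i + a).+1)%N = (a + i0 - i.+1)%N by lia.
  apply: le_trans (term_le _ _ _) _; [by lia|by apply/eqP; lia|].
  rewrite le_eqVlt; apply/orP; left; apply/eqP; congr phi.
  by rewrite /m; lia.
have right_le : \sum_(m.+1 <= l < a + d.+1) ((l < n)%N && ~~ small l)%:R / (e l)%:R <=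
    2 * block_sum d.+1.
  apply: le_trans (phi_sum (d - i0)%N _); last by lia.
  rewrite -{1}(add0n m.+1) big_addn.
  have -> : (a + d.+1 - m.+1 = d - i0)%N by rewrite /m; lia.
  rewrite big_nat [leRHS]big_nat; apply: ler_sum => i /andP[_ ii0].
  apply: le_trans (term_le _ _ _) _; [by rewrite /m; lia|by apply/eqP; lia|].
  rewrite le_eqVlt; apply/orP; left; apply/eqP; congr phi; lia.
have mid_le : ((m < n)%N && ~~ small m)%:R / (e m)%:R <= 2 / d%:R :> R.
  case: ltnP => mn /=; last by rewrite mul0r divr_ge0.
  case: (boolP (small m)) => sm /=; first by rewrite mul0r divr_ge0.
  have em0 : (0 < e m)%N by move: sm; rewrite /small; lia.
  rewrite ler_pdivrMr ?ltr0n // mulrAC ler_pdivlMr // mul1r -natrM ler_nat.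
  by move: sm; rewrite /small; lia.
lra.
Qed.

Lemma large_cut_sum :
  \sum_(1 <= l < n) (~~ small l)%:R / (e l)%:R <=
    (n %/ d.+1).+1%:R * (2 / d%:R + 4 * block_sum d.+1) :> R.
Proof.
set B := (n %/ d.+1).+1; set eta := 2 / _ + _.
have nB : (n <= B * d.+1)%N by rewrite ltnW // ltn_ceil.
apply: (@le_trans _ _ (\sum_(0 <= l < B * d.+1) ((l < n)%N && ~~ small l)%:R / (e l)%:R)).
  rewrite (@big_cat_nat _ _ _ n 0 (B * d.+1)) //= -[leLHS]addr0; apply: lerD; last by rewrite sumr_ge0 // => l _; rewrite divr_ge0.
  case: n nB => [|n' n'B]; first by rewrite !big_geq.
  rewrite [leRHS]big_ltn //= -[leLHS]add0r lerD ?divr_ge0 //.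
  by rewrite big_nat [leRHS]big_nat; apply: ler_sum => l /andP[_ ->].
rewrite big_nat_mul big_mkord.
apply: le_trans (_ : \sum_(i < B) eta <= _).
  by apply: ler_sum => i _; rewrite mulSn addnC block_bound.
by rewrite sumr_const card_ord mulr_natl.
Qed.

End WideGaps.

End CutSums.

(** * Trigonometric bounds *)

Section TrigBounds.
Variable R : realType.
Implicit Types x : R.

(** Iterated below: each Taylor bound for sine or cosine yields the next one by integration. *)
Lemma ge0_of_derive (f df : R -> R) x :
  (forall y : R, is_derive y 1 f (df y)) -> f 0 = 0 ->
  (forall y, 0 <= y -> 0 <= df y) -> 0 <= x -> 0 <= f x.
Proof.
move=> fdf f0 df0 x0.
have [|c cx] := @MVT_segment R f df 0 x x0 (fun y _ => fdf y).
  apply: derivable_within_continuous => y _; exact: ex_derive.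
rewrite f0 !subr0 => ->; rewrite mulr_ge0 ?df0 //.
by move: cx; rewrite in_itv /= => /andP[].
Qed.

Lemma sin_le x : 0 <= x -> sin x <= x.
Proof.
move=> x0; rewrite -subr_ge0.
apply: (ge0_of_derive (f := fun y => y - sin y) (df := fun y => 1 - cos y)) => //.
by rewrite sin0 subr0.
Qed.

Lemma cos_ge2 x : 0 <= x -> 1 - x ^+ 2 / 2 <= cos x.
Proof.
move=> x0; rewrite -subr_ge0.
apply: (ge0_of_derive (f := fun y => cos y - (1 - y ^+ 2 / 2))
  (df := fun y => y - sin y)) => //.
- by move=> y; apply: is_derive_eq; rewrite ?scaler0 /GRing.scale /=; field.
- by rewrite cos0; field.
- by move=> y y0; rewrite subr_ge0 sin_le.
Qed.

Lemma sin_ge3 x : 0 <= x -> x - x ^+ 3 / 6 <= sin x.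
Proof.
move=> x0; rewrite -subr_ge0.
apply: (ge0_of_derive (f := fun y => sin y - (y - y ^+ 3 / 6))
  (df := fun y => cos y - (1 - y ^+ 2 / 2))) => //.
- by move=> y; apply: is_derive_eq; rewrite ?scaler0 /GRing.scale /=; field.
- by rewrite sin0; field.
- by move=> y y0; rewrite subr_ge0 cos_ge2.
Qed.

Lemma cos_le4 x : 0 <= x -> cos x <= 1 - x ^+ 2 / 2 + x ^+ 4 / 24.
Proof.
move=> x0; rewrite -subr_ge0.
apply: (ge0_of_derive (f := fun y => 1 - y ^+ 2 / 2 + y ^+ 4 / 24 - cos y)
  (df := fun y => sin y - (y - y ^+ 3 / 6))) => //.
- by move=> y; apply: is_derive_eq; rewrite ?scaler0 /GRing.scale /=; field.
- by rewrite cos0; field.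
- by move=> y y0; rewrite subr_ge0 sin_ge3.
Qed.

(** Otherwise [sqrt 3 <= pi / 2], where the cosine is nonnegative; but the Taylor bound at [sqrt 3]
    is 1 - 3/2 + 9/24 = -1/8. *)
Lemma pi_sqr_lt12 : pi ^+ 2 < 12 :> R.
Proof.
rewrite ltNge; apply/negP => pi12.
pose s : R := Num.sqrt 3.
have s0 : 0 <= s by exact: sqrtr_ge0.
have s2 : s ^+ 2 = 3 by rewrite sqr_sqrtr.
have spi : s <= pi / 2.
  rewrite -ler_sqr ?nnegrE ?divr_ge0 ?pi_ge0 // s2 expr_div_n.
  by rewrite ler_pdivlMr //; move: pi12; lra.
have := @cos_ge0_pihalf R s; rewrite spi andbT.
have -> : - (pi / 2) <= s by apply: le_trans s0; rewrite oppr_le0 divr_ge0 ?pi_ge0.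
move=> /(_ isT); have := cos_le4 s0.
have -> : s ^+ 4 = 9 by rewrite (exprM s 2 2) s2; ring.
rewrite s2; lra.
Qed.

End TrigBounds.

(** * Bounds uniform in the degree *)

Section UniformBounds.
Variable R : realType.

Lemma relaxation_time_le (n d : nat) (G : sgraph n) (K : R) :
  (1 < n)%N -> (0 < d)%N -> regular G d -> 0 < K -> poincare G K ->
  relaxation_time R G <= d%:R * K.
Proof.
move=> n1 d0 reg K0 GK; rewrite (relaxation_timeE _ n1 d0 reg).
have mu_ge := alg_connectivity_ge n1 K0 GK.
have mu0 : 0 < alg_connectivity R G by apply: lt_le_trans mu_ge; rewrite invr_gt0.
by rewrite ler_wpM2l // invf_ple ?posrE.
Qed.

Lemma initial0 n (s : {perm 'I_n}) : initial s 0 = finset.set0.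
Proof. by apply/setP => x; rewrite !inE. Qed.

Lemma initialn n (s : {perm 'I_n}) : initial s n = [set: 'I_n]%SET.
Proof. by apply/setP => x; rewrite !inE ltn_ord. Qed.

Lemma cut_initial_n n (G : sgraph n) (s : {perm 'I_n}) : cut G (initial s n) = 0%N.
Proof. by rewrite initialn -finset.setC0 cutC cut0. Qed.

Lemma cut_initial_gt0 n (G : sgraph n) (s : {perm 'I_n}) k :
  Defs.connected G -> (0 < k < n)%N -> (0 < cut G (initial s k))%N.
Proof.
move=> Gconn /andP[k0 kn]; have n0 := leq_ltn_trans (leq0n k) kn.
apply: (@cut_gt0 _ _ _ (s (Ordinal n0)) (s (Ordinal kn))) => //;
by rewrite in_initial //= -leqNgt.
Qed.

Lemma cut_initial_add n d (G : sgraph n) (s : {perm 'I_n}) k l :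
  regular G d -> (k < l <= n)%N ->
  ((l - k) * (d.+1 - (l - k)) <= cut G (initial s k) + cut G (initial s l))%N.
Proof.
move=> reg /andP[kl ln]; have sub := initial_sub s (ltnW kl).
have := cut_add reg sub; rewrite cardsD (finset.setIidPr sub).
rewrite !card_initial ?(leq_trans (ltnW kl)) //.
move: (cut _ _) (cut _ _) => u v; move: (ltn0Sn (l - k).-1).
by rewrite prednK ?subn_gt0 //; case: (l - k)%N => // j _; nia.
Qed.

Lemma relaxation_le_small (n d : nat) (G : sgraph n) :
  (1 < n)%N -> Defs.connected G -> regular G d -> (0 < d <= 2)%N ->
  relaxation_time R G <= n%:R ^+ 2 / 8.
Proof.
move=> n1 Gconn reg /andP[d0 d2].
have n0 : 0 < n%:R :> R by rewrite ltr0n ltnW.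
have d0' : 0 < d%:R :> R by rewrite ltr0n.
have cut_ge (s : {perm 'I_n}) l : (0 < l < n)%N -> (d <= cut G (initial s l))%N.
  move=> ln; have := cut_initial_gt0 s Gconn ln.
  have [-> //|d_neq1] := eqVneq d 1%N; have d2' : d = 2%N by lia.
  rewrite d2' in reg *; have := odd_cut (initial s l) reg isT; case: (cut _ _) => [|[|]] //.
pose K : R := n%:R ^+ 3 / (8 * d%:R) / n%:R.
have K0 : 0 < K by rewrite !divr_gt0 ?exprn_gt0 ?mulr_gt0.
have -> : n%:R ^+ 2 / 8 = d%:R * K by rewrite /K; field; rewrite !gt_eqF.
apply: relaxation_time_le => //; apply: poincare_cuts => // s k /andP[k0 kn].
have := @tent_sum_le R n 1 k predT (ltnW kn) isT isT isT.
move=> /(_ (fun l l' => _)) tent_le.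
apply: (@le_trans _ _ ((\sum_(1 <= l < n) true%:R * tent R n k l) / d%:R)).
  rewrite mulr_suml big_nat [leRHS]big_nat; apply: ler_sum => l ln.
  rewrite mul1r ler_wpM2l // lef_pV2 ?posrE ?ltr0n ?ler_nat ?cut_ge //.
  exact: cut_initial_gt0.
rewrite invfM mulrA ler_wpM2r ?invr_ge0 //.
have := tent_le _; rewrite mulr1; apply.
by move=> l l' /andP[ll' _] _ _; rewrite addn1.
Qed.

Lemma aldous_fill_value_ge (n : nat) : n%:R ^+ 2 / 8 <= aldous_fill_value R n.
Proof.
have pi0 : 0 < pi ^+ 2 :> R by rewrite exprn_gt0 // pi_gt0.
rewrite /aldous_fill_value -mulrA mulrCA ler_wpM2l ?sqr_ge0 //.
move: (pi ^+ 2) pi0 (pi_sqr_lt12 R) => p p0 p12.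
by rewrite ler_pdivlMr ?mulr_gt0 //; lra.
Qed.

Lemma relaxation_le_large : exists D : nat, forall (n d : nat) (G : sgraph n),
  (D <= d)%N -> (1 < n)%N -> Defs.connected G -> regular G d ->
  relaxation_time R G <= aldous_fill_value R n.
Proof.
have pi0 : 0 < pi ^+ 2 :> R by rewrite exprn_gt0 // pi_gt0.
pose gap : R := 3 / (2 * pi ^+ 2) - 1 / 8.
have gap0 : 0 < gap.
  rewrite /gap; move: (pi ^+ 2) pi0 (pi_sqr_lt12 R) => p p0 p12.
  by rewrite subr_gt0 ltr_pdivlMr ?mulr_gt0 //; lra.
have gap4 : 0 < gap / 4 by rewrite divr_gt0.
have [D DP] := block_sum_small gap4.
(* The two thresholds give [eta / 2 = 1 / d + 2 * block_sum <= gap / 2 + gap / 2]. *)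
pose D' := (Num.truncn (2 / gap)).+1.
exists (maxn D D') => n d G; rewrite geq_max => /andP[Dd D'd] n1 Gconn reg.
have d0 : (0 < d)%N by exact: leq_trans D'd.
have n0 : 0 < n%:R :> R by rewrite ltr0n ltnW.
have d0' : 0 < d%:R :> R by rewrite ltr0n.
have bs := DP d.+1 (leqW Dd).
have d_inv : d%:R^-1 <= gap / 2.
  rewrite -[leRHS]invrK lef_pV2 ?posrE ?invr_gt0 ?divr_gt0 // invf_div.
  apply: le_trans (ltW (truncnS_gt _)) _; rewrite ler_nat //.
have dn : (d < n)%N.
  have x : 'I_n := Ordinal n1.
  rewrite -(reg x) /deg -[X in (_ < X)%N](card_ord n) -cardsT.
  apply: fintype.proper_card; apply/fintype.properP; split; first exact: finset.subsetT.
  by exists x; rewrite !inE ?adj_irr.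
set eta : R := 2 / d%:R + 4 * block_sum R d.+1.
have bs0 : 0 <= block_sum R d.+1 by rewrite sumr_ge0.
have eta0 : 0 <= eta by rewrite addr_ge0 ?mulr_ge0 ?invr_ge0.
(* Small cuts have at least one edge and are [d.+1] apart; every other cut is charged the maximum
   [n^2 / 4] of the tent. *)
pose M : R := n%:R ^+ 3 / (8 * d.+1%:R) + n%:R ^+ 2 / 4 * ((n %/ d.+1).+1%:R * eta).
have M0 : 0 < M.
  by rewrite ltr_pwDl ?divr_gt0 ?mulr_gt0 ?exprn_gt0 // !mulr_ge0 ?sqr_ge0.
have poinc : poincare G (M / n%:R).
  apply: poincare_cuts => // s k /andP[k0 kn].
  pose e l := cut G (initial s l).
  have e_gt0 l : (0 < l < n)%N -> (0 < e l)%N by exact: cut_initial_gt0.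
  have e_add k' l : (k' < l <= n)%N -> ((l - k') * (d.+1 - (l - k')) <= e k' + e l)%N.
    exact: cut_initial_add.
  pose small l := (e l * 2 < d)%N.
  have small0 : small 0%N by rewrite /small /e initial0 cut0.
  have smalln : small n by rewrite /small /e cut_initial_n.
  have tle := @tent_sum_le R n d.+1 k small (ltnW kn) isT small0 smalln
    (small_gap d0 e_add).
  have lle := @large_cut_sum R n d e d0 e_add.
  rewrite -/eta in lle.
  apply: (@le_trans _ _ (\sum_(1 <= l < n) (small l)%:R * tent R n k l +
     n%:R ^+ 2 / 4 * \sum_(1 <= l < n) (~~ small l)%:R / (e l)%:R)).
    rewrite mulr_sumr -big_split [leLHS]big_nat [leRHS]big_nat.
    apply: ler_sum => l ln; rewrite -/(tent R n k l) -/(e l) /=.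
    have el0 : 0 < (e l)%:R :> R by rewrite ltr0n e_gt0.
    case: (small l) => /=; rewrite ?mul0r ?mulr0 ?addr0 ?mul1r ?add0r.
      rewrite -[leRHS]mulr1 ler_wpM2l ?tent_ge0 // invf_le1 //.
      by rewrite (ler_nat _ 1) e_gt0.
    rewrite ler_wpM2r ?invr_ge0 ?(ltW el0) // tent_max ?(ltnW kn) //.
    by case/andP: ln => _ /ltnW.
  rewrite lerD // ler_wpM2l ?divr_ge0 ?sqr_ge0 //.
apply: le_trans (relaxation_time_le n1 d0 reg _ poinc) _; first by rewrite divr_gt0.
have div_le : (n %/ d.+1).+1%:R <= 2 * n%:R / d.+1%:R :> R.
  rewrite ler_pdivlMr // -!natrM ler_nat.
  by rewrite mulSn mul2n -addnn leq_add // leq_trunc_div.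
have -> : aldous_fill_value R n = n%:R ^+ 2 * (1 / 8 + gap).
  by rewrite /gap /aldous_fill_value; move: (pi ^+ 2) pi0 => p p0; field; rewrite gt_eqF.
apply: (@le_trans _ _ (d%:R * ((n%:R ^+ 3 / (8 * d.+1%:R) +
    n%:R ^+ 2 / 4 * (2 * n%:R / d.+1%:R * eta)) / n%:R))).
  rewrite ler_wpM2l // ler_wpM2r ?invr_ge0 // lerD2l.
  by rewrite ler_wpM2l ?divr_ge0 ?sqr_ge0 // ler_wpM2r.
have -> : d%:R * ((n%:R ^+ 3 / (8 * d.+1%:R) +
    n%:R ^+ 2 / 4 * (2 * n%:R / d.+1%:R * eta)) / n%:R) =
  n%:R ^+ 2 * ((1 / 8 + eta / 2) * (d%:R / d.+1%:R)).
  have w0 : 0 < d.+1%:R :> R by rewrite ltr0n.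
  by move: eta (d.+1%:R) w0 {eta0 M M0 poinc} => h w w0; field; rewrite !gt_eqF.
rewrite ler_wpM2l ?sqr_ge0 //.
apply: (@le_trans _ _ (1 / 8 + eta / 2)).
  rewrite -[leRHS]mulr1 ler_wpM2l ?addr_ge0 ?divr_ge0 //.
  by rewrite ler_pdivrMr // mul1r ler_nat.
by rewrite lerD2l /eta; move: d_inv bs; clearbody gap; move: (d%:R^-1) (block_sum R d.+1) => u v; lra.
Qed.

End UniformBounds.

(** * Wirtinger's inequality on a path *)

Section PathInequality.
Variable R : realType.
Implicit Types (S h : nat -> R) (N m : nat).

Definition angle N : R := pi / N%:R.

(* The comparison function is the first Dirichlet eigenvector
   [i |-> sin (pi i / N)] of the path. *)
Lemma dirichlet_path S N : (0 < N)%N -> S 0%N = 0 -> S N = 0 ->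
  (2 - 2 * cos (angle N)) * \sum_(0 <= i < N) S i ^+ 2 <=
    \sum_(0 <= i < N) (S i.+1 - S i) ^+ 2.
Proof.
move=> N0 S0 SN; have N0' : 0 < N%:R :> R by rewrite ltr0n.
pose phi i : R := sin (angle N * i%:R).
have phi_gt0 i : (0 < i < N)%N -> 0 < phi i.
  move=> /andP[i0 iN]; apply: sin_gt0_pi; rewrite /angle.
  rewrite !mulr_gt0 ?invr_gt0 ?pi_gt0 ?ltr0n //=.
  by rewrite mulrAC ltr_pdivrMr // ltr_pM2l ?pi_gt0 // ltr_nat.
have phi0 : phi 0%N = 0 by rewrite /phi mulr0 sin0.
have phi_add i : phi i.+2 + phi i = 2 * cos (angle N) * phi i.+1.
  rewrite /phi; have -> : angle N * i.+2%:R = angle N * i.+1%:R + angle N.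
    by rewrite -!natr1; ring.
  have -> : angle N * i%:R = angle N * i.+1%:R - angle N by rewrite -natr1; ring.
  by rewrite sinD sinB; ring.
(* Picone's identity: [(S i.+1 - S i) ^+ 2] is [a i + b i.+1] plus a nonnegative term. Regrouped as
   [a i + b i], it shows [(phi i.+1 + phi i.-1) / phi i], which the recurrence evaluates. Where
   [phi] vanishes, at the two ends, [S] vanishes too. *)
pose a i := S i ^+ 2 * (1 - phi i.+1 / phi i).
pose b i := S i ^+ 2 * (1 - phi i.-1 / phi i).
have step i : (i < N)%N -> a i + b i.+1 <= (S i.+1 - S i) ^+ 2.
  rewrite /a /b /= => iN; have [i0|i_gt0] := posnP i.
    by rewrite i0 S0 expr0n mul0r add0r subr0 phi0 mul0r subr0 mulr1.
  have [iN1|iN1] := eqVneq i.+1 N.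
    rewrite iN1 SN expr0n mul0r addr0 sub0r sqrrN.
    have -> : phi N = 0 by rewrite /phi /angle divfK ?gt_eqF // sinpi.
    by rewrite mul0r subr0 mulr1.
  have p0 : 0 < phi i by rewrite phi_gt0 // i_gt0.
  have q0 : 0 < phi i.+1 by rewrite phi_gt0 //= ltn_neqAle iN1.
  move: (phi i) (phi i.+1) (S i) (S i.+1) p0 q0 => p q x y p0 q0.
  rewrite -subr_ge0.
  have -> : (y - x) ^+ 2 - (x ^+ 2 * (1 - q / p) + y ^+ 2 * (1 - p / q)) =
      (x * q - y * p) ^+ 2 / (p * q) by field; rewrite !gt_eqF.
  by rewrite divr_ge0 ?sqr_ge0 // mulr_ge0 // ltW.
have shift : \sum_(0 <= i < N) b i.+1 = \sum_(0 <= i < N) b i.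
  have := @big_nat_recl _ 0 +%R N 0 b isT; rewrite (@big_nat_recr _ _ _ N 0) //=.
  have b0 : b 0%N = 0 by rewrite /b S0 expr0n mul0r.
  have bN : b N = 0 by rewrite /b SN expr0n mul0r.
  by rewrite b0 bN add0r addr0 => ->.
apply: (@le_trans _ _ (\sum_(0 <= i < N) (a i + b i.+1))); last first.
  by rewrite big_nat [leRHS]big_nat; apply: ler_sum => i iN; exact: step.
rewrite big_split /= shift -big_split mulr_sumr [leLHS]big_nat [leRHS]big_nat /=.
apply: ler_sum => i iN; rewrite /a /b; case: i iN => [|i iN].
  by rewrite S0 expr0n !mul0r mulr0 addr0.
have p0 : 0 < phi i.+1 by exact: phi_gt0.
rewrite le_eqVlt; apply/orP; left; apply/eqP; rewrite /=.
have -> : S i.+1 ^+ 2 * (1 - phi i.+2 / phi i.+1) + S i.+1 ^+ 2 * (1 - phi i / phi i.+1)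
  = S i.+1 ^+ 2 * (2 - (phi i.+2 + phi i) / phi i.+1).
  by move: (phi _) (phi i.+1) (phi _) p0 => p q r q0; field; rewrite gt_eqF.
by rewrite phi_add mulfK ?gt_eqF // mulrC.
Qed.

(** The free path is dual to the path with fixed ends: the partial sums [S] of [h] have increments
    [h] and vanish at both ends, and summation by parts expresses [sum h^2] through [S] and the
    increments of [h]. *)
Lemma wirtinger_path h M (lam := 2 - 2 * cos (angle M.+1)) : 0 < lam ->
  \sum_(0 <= i < M.+1) h i = 0 ->
  lam * \sum_(0 <= i < M.+1) h i ^+ 2 <= \sum_(0 <= i < M) (h i.+1 - h i) ^+ 2.
Proof.
move=> lam0 h0; pose S k := \sum_(0 <= i < k) h i.
have S0 : S 0%N = 0 by rewrite /S big_geq.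
have SN : S M.+1 = 0 by [].
have Sdiff i : S i.+1 - S i = h i by rewrite /S big_nat_recr //= addrAC subrr add0r.
set X := \sum_(0 <= i < M.+1) h i ^+ 2; set Y := \sum_(0 <= i < M) _.
have dir := dirichlet_path (ltn0Sn M) S0 SN.
have {}dir : lam * \sum_(0 <= i < M) S i.+1 ^+ 2 <= X.
  move: dir; rewrite big_nat_recl // S0 expr0n add0r => dir.
  by apply: le_trans dir _; rewrite /X; under eq_bigr do rewrite Sdiff.
have XE : X = \sum_(0 <= i < M) (h i - h i.+1) * S i.+1.
  transitivity (\sum_(0 <= i < M.+1) h i * S i.+1 - \sum_(0 <= i < M.+1) h i * S i).
    by rewrite -sumrB; apply: eq_bigr => i _; rewrite -mulrBr Sdiff expr2.
  rewrite big_nat_recr //= SN mulr0 addr0 [X in _ - X]big_nat_recl // S0 mulr0 add0r.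
  by rewrite -sumrB; apply: eq_bigr => i _; rewrite mulrBl.
(* The weights are such that the Dirichlet bound returns half of [lam * X], which is absorbed on the
   left. *)
have : lam * X <= (lam * (lam * \sum_(0 <= i < M) S i.+1 ^+ 2) + Y) / 2.
  rewrite XE /Y !mulr_sumr -big_split mulr_suml; apply: ler_sum => i _ /=.
  rewrite ler_pdivlMr // -subr_ge0.
  have -> : lam * (lam * S i.+1 ^+ 2) + (h i.+1 - h i) ^+ 2 -
     lam * ((h i - h i.+1) * S i.+1) * 2 = (lam * S i.+1 - (h i - h i.+1)) ^+ 2.
    by ring.
  exact: sqr_ge0.
have := ler_wpM2l (ltW lam0) dir.
move: (lam * (lam * _)) (lam * X) => u v; lra.
Qed.

(** The Taylor bound gives [2 - 2 cos a >= a^2 - a^4 / 12], and [pi^2 < 12] gives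
    [a^4 / 12 <= a^2 / N^2]. *)
Lemma eigenvalue_path_ge N : (0 < N)%N ->
  angle N ^+ 2 * (1 - N%:R^-2) <= 2 - 2 * cos (angle N).
Proof.
move=> N0; have N0' : 0 < N%:R :> R by rewrite ltr0n.
have a0 : 0 <= angle N by rewrite divr_ge0 ?pi_ge0.
have := cos_le4 a0; have : angle N ^+ 2 * angle N ^+ 2 <= angle N ^+ 2 * (12 * N%:R^-2).
  rewrite ler_wpM2l ?sqr_ge0 // expr_div_n ler_wpM2r ?invr_ge0 ?sqr_ge0 //.
  exact/ltW/pi_sqr_lt12.
have -> : angle N ^+ 4 = angle N ^+ 2 * angle N ^+ 2 by rewrite -exprD.
move: (angle N ^+ 2) (N%:R ^- 2) (cos _) => x y z; rewrite mulrBr mulr1 mulrCA.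
move: (x * y) (x * x) => u v; lra.
Qed.

(** Multiplication by [2 sin (t / 2)] makes the sum telescope to the difference of the two sines
    that are assumed equal. *)
Lemma sum_cos (a t : R) m : sin (t / 2) != 0 ->
  sin (a + m%:R * t - t / 2) = sin (a - t / 2) ->
  \sum_(0 <= j < m) cos (a + j%:R * t) = 0.
Proof.
move=> s0 per; have s2 : 2 * sin (t / 2) != 0 by rewrite mulf_neq0 ?pnatr_eq0.
apply: (mulIf s2).
transitivity (sin (a + m%:R * t - t / 2) - sin (a - t / 2)); last first.
  by rewrite per subrr mul0r.
clear per; elim: m => [|m IH].
  by rewrite big_geq // !mul0r addr0 subrr.
rewrite big_nat_recr //= mulrDl IH.
have -> : a + m.+1%:R * t - t / 2 = a + m%:R * t + t / 2 by rewrite -natr1; field.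
by move: (a + m%:R * t) => u; rewrite (sinB u) (sinD u); ring.
Qed.

End PathInequality.

(** * Patterned graphs *)

Section LocalBounds.
Variables (R : realType) (n : nat) (G : sgraph n).
Implicit Types (f : 'I_n -> R) (x y u v : 'I_n) (X Y A W : {set 'I_n}).

Lemma edge_energy f x y : G x y -> (f x - f y) ^+ 2 <= energy G f.
Proof.
move=> Gxy; have xy : y != x by apply: contraTneq Gxy => ->; rewrite adj_irr.
rewrite ler_pdivlMr // mulr_natr mulr2n.
have row z : 0 <= \sum_t (G z t)%:R * (f z - f t) ^+ 2.
  by rewrite sumr_ge0 // => t _; rewrite mulr_ge0 ?sqr_ge0.
have entry z t : G z t ->
    (f z - f t) ^+ 2 <= \sum_t (G z t)%:R * (f z - f t) ^+ 2.
  move=> Gzt; rewrite (bigD1 t) //= Gzt mul1r lerDl sumr_ge0 // => s _.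
  by rewrite mulr_ge0 ?sqr_ge0.
rewrite (bigD1 x) // (bigD1 y) //= lerD ?entry //.
rewrite -[leLHS]addr0 lerD ?sumr_ge0 //.
by rewrite -(sqrrN (f x - f y)) opprB entry // adj_sym.
Qed.

Lemma seq_join_energy M K (P : nat -> {set 'I_n}) f : seq_join G M K P ->
  \sum_(0 <= i < K.-1) \sum_(x in P i) \sum_(y in P i.+1) (f x - f y) ^+ 2 <=
    energy G f.
Proof.
case=> ME dis adjP _; rewrite ler_pdivlMr // mulr_natr mulr2n.
pose w x y : R := (G x y)%:R * (f x - f y) ^+ 2.
have w0 x y : 0 <= w x y by rewrite mulr_ge0 ?sqr_ge0.
pose q i := \sum_(x in P i) \sum_(y in P i.+1) (f x - f y) ^+ 2.
(* [seq_join] does not constrain [P K], so the last layer gets the empty set above it. *)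
pose up i := if (i.+1 < K)%N then P i.+1 else finset.set0.
pose down i := if i is j.+1 then P j else finset.set0.
have dis_ord (i j : 'I_K) : i != j -> [disjoint P i & P j].
  move=> ij; case: (ltngtP i j) => [lt_ij|lt_ji|/val_inj/eqP]; last by rewrite (negPf ij).
    by apply: dis; rewrite lt_ij ltn_ord.
  by rewrite disjoint_sym; apply: dis; rewrite lt_ji ltn_ord.
apply: (@le_trans _ _ (\sum_(0 <= i < K) \sum_(x in P i)
    (\sum_(y in up i) w x y + \sum_(y in down i) w x y))).
  under [leRHS]eq_bigr do rewrite big_split /=.
  rewrite big_split /=; case: K @up @q ME dis adjP dis_ord => [|K] up q _ dis adjP _ /=.
    by rewrite !big_geq // addr0.
  rewrite [X in _ <= X + _]big_nat_recr //= [X in _ <= _ + X]big_nat_recl //=.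
  apply: lerD.
    rewrite -[leLHS]addr0; apply: lerD; last first.
      by apply: sumr_ge0 => x _; apply: sumr_ge0 => y _.
    rewrite big_nat [leRHS]big_nat; apply: ler_sum => i /andP[_ iK].
    rewrite /up ltnS iK; apply: ler_sum => x xi; apply: ler_sum => y yi.
    by rewrite /w (adjP i) ?mul1r // ltnS.
  rewrite -[leLHS]add0r; apply: lerD; first by apply: sumr_ge0 => x _; apply: sumr_ge0 => y _.
  rewrite big_nat [leRHS]big_nat; apply: ler_sum => i /andP[_ iK].
  rewrite exchange_big /=; apply: ler_sum => y yi; apply: ler_sum => x xi.
  by rewrite /w adj_sym (adjP i) ?mul1r ?ltnS // -(sqrrN (f x - f y)) opprB.
apply: (@le_trans _ _ (\sum_(x in M) \sum_y w x y)); last first.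
  rewrite [leRHS](bigID (mem M)) /= lerDl sumr_ge0 // => x _.
  by apply: sumr_ge0 => y _; exact: w0.
rewrite ME (partition_disjoint_bigcup _ _ dis_ord) big_mkord.
apply: ler_sum => i _; apply: ler_sum => x xi.
have dud : [disjoint up i & down i].
  rewrite /up /down; case: ifP => iK; last by rewrite finset.disjoints_subset finset.sub0set.
  case: (val i) iK => [|j] jK; first by rewrite disjoint_sym finset.disjoints_subset finset.sub0set.
  by rewrite disjoint_sym; apply: dis; rewrite jK andbT leqW.
rewrite -bigU //= [leRHS](bigID (mem [predU up i & down i])) /=.
by rewrite lerDl sumr_ge0.
Qed.

(* The join of a vertex, X, Y and a vertex, in series, has effective resistance at
   most [1 / #|X| + 1 / (#|X| * #|Y|) + 1 / #|Y|]. *)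
Lemma join_chain_bound X Y f (u v : R) :
  #|X|%:R * #|Y|%:R * (v - u) ^+ 2 <= (1 + #|X|%:R + #|Y|%:R) *
   (\sum_(x in X) (u - f x) ^+ 2 + \sum_(x in X) \sum_(y in Y) (f x - f y) ^+ 2 +
    \sum_(y in Y) (f y - v) ^+ 2).
Proof.
set p : R := #|X|%:R; set q : R := #|Y|%:R; set D := v - u.
have p0 : 0 <= p by []; have q0 : 0 <= q by [].
have w0 : 0 < 1 + p + q by rewrite -addrA ltr_wpDr ?addr_ge0.
(* At equilibrium the potential drops by [q * k] on the edges at [u], by [k] between [X] and [Y],
   and by [p * k] on the edges at [v]. Each square is bounded below by its tangent at that drop, and
   the linear terms then add up to a multiple of [v - u]. *)
pose k := D / (1 + p + q).
have tangent (s t : R) : 2 * s * t - s ^+ 2 <= t ^+ 2.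
  by rewrite -subr_ge0 (_ : _ - _ = (t - s) ^+ 2) ?sqr_ge0 //; ring.
have sX : \sum_(x in X) (2 * (q * k) * (f x - u) - (q * k) ^+ 2) <=
    \sum_(x in X) (u - f x) ^+ 2.
  by apply: ler_sum => x _; rewrite -(sqrrN (u - f x)) opprB; exact: tangent.
have sXY : \sum_(x in X) \sum_(y in Y) (2 * k * (f y - f x) - k ^+ 2) <=
    \sum_(x in X) \sum_(y in Y) (f x - f y) ^+ 2.
  apply: ler_sum => x _; apply: ler_sum => y _.
  by rewrite -(sqrrN (f x - f y)) opprB; exact: tangent.
have sY : \sum_(y in Y) (2 * (p * k) * (v - f y) - (p * k) ^+ 2) <=
    \sum_(y in Y) (f y - v) ^+ 2.
  by apply: ler_sum => y _; rewrite -(sqrrN (f y - v)) opprB; exact: tangent.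
have sumc (Z : {set 'I_n}) (c : R) : \sum_(x in Z) c = #|Z|%:R * c.
  by rewrite sumr_const mulr_natl.
apply: (@le_trans _ _ ((1 + p + q) * (2 * k * (p * q * D) - k ^+ 2 * (p * q * (1 + p + q))))).
  rewrite le_eqVlt; apply/orP; left; apply/eqP.
  by rewrite /k; field; rewrite gt_eqF.
rewrite ler_wpM2l ?(ltW w0) //.
apply: le_trans (lerD (lerD sX sXY) sY).
rewrite le_eqVlt; apply/orP; left; apply/eqP.
have -> : \sum_(x in X) \sum_(y in Y) (2 * k * (f y - f x) - k ^+ 2) =
   2 * k * (p * (\sum_(y in Y) f y) - q * \sum_(x in X) f x) - p * q * k ^+ 2.
  transitivity (\sum_(x in X) (2 * k * (\sum_(y in Y) f y - q * f x) - q * k ^+ 2)).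
    apply: eq_bigr => x _; rewrite sumrB sumc -mulr_sumr sumrB sumc //.
  by rewrite sumrB sumc -mulr_sumr sumrB sumc -mulr_sumr mulrA.
rewrite !sumrB !sumc -!mulr_sumr !sumrB !sumc -/p -/q /D; ring.
Qed.

Lemma connected_exit A x z : Defs.connected G -> x \in A -> z \notin A ->
  exists u v, [/\ u \in A, v \notin A & G u v].
Proof.
move=> Gconn xA zA; have := cut_gt0 Gconn xA zA; rewrite /cut /edges_between.
case: (boolP [exists u in A, exists v in ~: A, G u v]) => [/exists_inP[u uA /exists_inP[v vA uv]]|no].
  by move=> _; exists u, v; rewrite finset.in_setC in vA.
rewrite big1 // => u uA; rewrite big1 // => v vA.
apply/eqP; rewrite eqb0; apply: contra no => uv.
by apply/exists_inP; exists u => //; apply/exists_inP; exists v.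
Qed.

(** Along an edge [f] changes by at most the root of the energy, and at most [#|A|] edges lead out
    of [A]. Instead of a path, the sets [near t] are grown: each step reaches [W] or gains a vertex
    of [A]. *)
Lemma exit_bound A W f x z : Defs.connected G -> x \in A -> z \notin A ->
  (forall u v, u \in A -> v \notin A -> G u v -> v \in W) ->
  exists2 w, w \in W & (f x - f w) ^+ 2 <= #|A|%:R ^+ 2 * energy G f.
Proof.
move=> Gconn xA zA exits; set E := energy G f; pose delta := Num.sqrt E.
have E0 : 0 <= E := energy_ge0 G f.
have delta0 : 0 <= delta := sqrtr_ge0 E.
have edge u v : G u v -> `|f u - f v| <= delta.
  by move=> uv; rewrite -sqrtr_sqr ler_wsqrtr // edge_energy.
pose near t := [set y in A | `|f x - f y| <= t%:R * delta]%SET.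
have claim t : (exists2 w, w \in W & `|f x - f w| <= t%:R * delta) \/ (t < #|near t|)%N.
  elim: t => [|t [[w wW fw]|IH]].
  - right; apply/card_gt0P; exists x.
    by rewrite inE xA subrr normr0 mul0r /=.
  - left; exists w => //; apply: le_trans fw _.
    by rewrite ler_wpM2r // ler_nat.
  have zt : z \notin near t by rewrite inE negb_and zA.
  have xt : x \in near t by rewrite inE xA subrr normr0 mulr_ge0.
  have [u [v [ut vt uv]]] := connected_exit Gconn xt zt.
  have fv : `|f x - f v| <= t.+1%:R * delta.
    move: ut; rewrite inE => /andP[_ fu].
    have -> : f x - f v = (f x - f u) + (f u - f v) by ring.
    by apply: le_trans (ler_normD _ _) _; rewrite -natr1 mulrDl mul1r lerD ?edge.
  have uA : u \in A by move: ut; rewrite inE => /andP[].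
  have [vA|vA] := boolP (v \in A); last by left; exists v => //; apply: exits uv.
  right; apply: leq_ltn_trans IH _; apply: fintype.proper_card.
  apply/fintype.properP; split; last by exists v => //; rewrite inE vA.
  apply/fintype.subsetP => y; rewrite !inE => /andP[-> /= /le_trans]; apply.
  by rewrite ler_wpM2r // ler_nat.
case: (claim #|A|) => [[w wW fw]|]; last first.
  rewrite ltnNge fintype.subset_leq_card //; apply/fintype.subsetP => y.
  by rewrite inE => /andP[].
exists w => //; rewrite -(sqr_sqrtr E0) -exprMn -/delta -(real_normK (num_real (f x - f w))).
by rewrite ler_sqr ?nnegrE ?mulr_ge0.
Qed.

End LocalBounds.

(** * Reduction of a patterned graph to a path *)

Section PatternedPoincare.
Variable R : realType.

Lemma sum_by_three (F : nat -> R) m :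
  \sum_(0 <= i < 3 * m) F i =
  \sum_(0 <= j < m) (F (3 * j)%N + F (3 * j).+1 + F (3 * j).+2).
Proof.
elim: m => [|m IH]; first by rewrite !big_geq.
by rewrite mulnS !big_nat_recr //= -IH !addrA.
Qed.

Lemma sum_three_parts (F : nat -> R) a k b :
  \sum_(0 <= i < a + k + b) F i = \sum_(0 <= i < a) F i +
    \sum_(0 <= i < k) F (a + i)%N + \sum_(0 <= i < b) F (a + k + i)%N.
Proof.
have shift c e : \sum_(c <= i < c + e) F i = \sum_(0 <= i < e) F (c + i)%N.
  rewrite -{1}(add0n c) big_addn addKn.
  by apply: eq_bigr => i _; rewrite addnC.
rewrite -!shift (@big_cat_nat _ _ _ (a + k)) ?leq_addr //=; congr (_ + _).
by rewrite (@big_cat_nat _ _ _ a) ?leq_addr.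
Qed.

Lemma sqr_split (eps s t : R) : 0 < eps ->
  (s + t) ^+ 2 <= (1 + eps) * s ^+ 2 + (1 + eps^-1) * t ^+ 2.
Proof.
move=> e0; rewrite -subr_ge0.
have -> : (1 + eps) * s ^+ 2 + (1 + eps^-1) * t ^+ 2 - (s + t) ^+ 2 =
    eps^-1 * (eps * s - t) ^+ 2 by field; rewrite gt_eqF.
by rewrite mulr_ge0 ?sqr_ge0 ?invr_ge0 ?ltW.
Qed.

(* The end pieces [A] and [B] are absorbed by lengthening the path with copies of
   its end values, which costs no energy. *)
Lemma padded_wirtinger (h : nat -> R) a m b (lam := 2 - 2 * cos (angle R (a + m + b))) :
  (0 < m)%N -> 0 < lam -> exists c,
  lam * (a%:R * (h 0%N - c) ^+ 2 + \sum_(0 <= j < m) (h j - c) ^+ 2 +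
         b%:R * (h m.-1 - c) ^+ 2) <=
    \sum_(0 <= j < m.-1) (h j.+1 - h j) ^+ 2.
Proof.
move=> m0; have N0 : (0 < a + m + b)%N by lia.
(* Truncated subtraction and [minn] clamp the index, which adds [a] copies of the first value and
   [b] of the last. *)
pose hh i := h (minn (i - a) m.-1).
pose c := (\sum_(0 <= i < a + m + b) hh i) / (a + m + b)%:R.
rewrite /lam -(prednK N0) => lam0; exists c.
have := wirtinger_path (h := fun i => hh i - c) lam0.
have hh_left i : (i <= a)%N -> hh i = h 0%N.
  by move=> ia; rewrite /hh; congr h; lia.
have hh_mid i : (i < m)%N -> hh (a + i)%N = h i.
  by move=> im; rewrite /hh; congr h; lia.
have hh_right i : hh (a + m.-1 + i)%N = h m.-1.
  by rewrite /hh; congr h; lia.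
have hh_right' i : hh (a + m + i)%N = h m.-1.
  by rewrite /hh; congr h; lia.
have sumc k (x : R) : \sum_(0 <= i < k) x = k%:R * x.
  by rewrite sumr_const_nat subn0 mulr_natl.
have padE : \sum_(0 <= i < a + m + b) (hh i - c) ^+ 2 =
    a%:R * (h 0%N - c) ^+ 2 + \sum_(0 <= j < m) (h j - c) ^+ 2 +
    b%:R * (h m.-1 - c) ^+ 2.
  rewrite sum_three_parts; congr (_ + _ + _).
  - by rewrite -sumc big_nat [RHS]big_nat; apply: eq_bigr => i /andP[_ ia]; rewrite hh_left // ltnW.
  - by rewrite big_nat [RHS]big_nat; apply: eq_bigr => i /andP[_ im]; rewrite hh_mid.
  - by rewrite -sumc; apply: eq_bigr => i _; rewrite hh_right'.
rewrite prednK // padE => W; apply: le_trans (W _) _.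
  by rewrite sumrB sumc /c mulrCA mulfV ?mulr1 ?subrr // pnatr_eq0 -lt0n.
have -> : (a + m + b).-1 = (a + m.-1 + b)%N by lia.
rewrite sum_three_parts [X in X + _ + _]big_nat big1 ?add0r => [|i /andP[_ ia]]; last first.
  by rewrite !hh_left ?(ltnW ia) // subrr expr0n.
rewrite [X in _ + X]big1 ?addr0 => [|i _]; last first.
  by rewrite -addnS !hh_right subrr expr0n.
rewrite big_nat [leRHS]big_nat; apply: ler_sum => i /andP[_ im].
by rewrite -addnS !hh_mid; [rewrite (_ : _ - c - _ = h i.+1 - h i) //; ring|lia|lia].
Qed.

Lemma pattern_mod d j r : (r < 3)%N -> pattern d (3 * j + r) = pattern d r.
Proof. by move=> r3; rewrite /pattern mulnC modnMDl. Qed.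

Lemma pattern0 d : pattern d 0 = 1%N.
Proof. by rewrite /pattern; case: odd. Qed.

(** The last bound is [d / (p1 p2) <= 3 / 2], an equality at [d = 3]: the source of the conjectured
    constant. *)
Lemma pattern12 d : (3 <= d)%N ->
  [/\ (0 < pattern d 1)%N, (0 < pattern d 2)%N, (pattern d 1 + pattern d 2 = d)%N &
      (2 * d <= 3 * (pattern d 1 * pattern d 2))%N].
Proof.
move=> d3; rewrite /pattern; case: (boolP (odd d)) => d_odd /=; split; lia.
Qed.

Section Decomposition.
Variables (n : nat) (G : sgraph n) (d m : nat).
Variables (A M B : {set 'I_n}) (P : nat -> {set 'I_n}).
Hypothesis d3 : (3 <= d)%N.
Hypothesis cover : (A :|: M :|: B = [set: 'I_n])%SET.
Hypotheses (disAM : [disjoint A & M]) (disAB : [disjoint A & B])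
  (disMB : [disjoint M & B]).
Hypothesis m_gt0 : (0 < m)%N.
Hypothesis join : seq_join G M (3 * m) P.
Hypothesis cardP : forall i, (i < 3 * m)%N -> #|P i| = pattern d i.
Implicit Type f : 'I_n -> R.

Lemma sum_vertices (F : 'I_n -> R) :
  \sum_x F x = \sum_(x in A) F x + \sum_(x in B) F x +
    \sum_(0 <= j < m) (\sum_(x in P (3 * j)%N) F x +
      \sum_(x in P (3 * j).+1) F x + \sum_(x in P (3 * j).+2) F x).
Proof.
have [ME dis _ _] := join.
have dis_ord (i j : 'I_(3 * m)) : i != j -> [disjoint P i & P j].
  move=> ij; case: (ltngtP i j) => [lt_ij|lt_ji|/val_inj/eqP]; last by rewrite (negPf ij).
    by apply: dis; rewrite lt_ij ltn_ord.
  by rewrite disjoint_sym; apply: dis; rewrite lt_ji ltn_ord.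
rewrite -(sum_by_three (fun i => \sum_(x in P i) F x)) big_mkord -(partition_disjoint_bigcup _ _ dis_ord) -ME.
rewrite addrAC -bigU //= -bigU /=; last first.
  apply/pred0P => x; rewrite /= !inE.
  by case: (boolP (x \in A)) => [/(disjointFr disAB)|] //=;
     case: (boolP (x \in M)) => [/(disjointFr disMB)|].
apply: eq_bigl => x; have := finset.in_setT x; rewrite -cover !inE => /esym.
by [].
Qed.

Lemma card_period j : (j < m)%N ->
  [/\ #|P (3 * j)%N| = 1%N, #|P (3 * j).+1| = pattern d 1 &
      #|P (3 * j).+2| = pattern d 2].
Proof.
move=> jm; have lt3 r : (r < 3)%N -> (3 * j + r < 3 * m)%N by clear -jm; lia.
by split; [rewrite -[X in P X]addn0|rewrite -addn1|rewrite -addn2];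
   rewrite cardP ?lt3 // pattern_mod // pattern0.
Qed.

Lemma card_vertices : n%:R = #|A|%:R + #|B|%:R + m%:R * d.+1%:R :> R.
Proof.
have [_ _ p12 _] := pattern12 d3.
have := sum_vertices (fun=> 1); rewrite !sumr_const card_ord => ->.
congr (_ + _); rewrite big_nat (eq_bigr (fun=> d.+1%:R)) => [|j jm].
  by rewrite -big_nat sumr_const_nat subn0 mulr_natl.
have [c0 c1 c2] := card_period jm.
by rewrite !sumr_const c0 c1 c2 -!natrD -addnA p12 add1n.
Qed.

Lemma centers : exists u : nat -> 'I_n, forall j, (j < m)%N -> P (3 * j)%N = [set u j]%SET.
Proof.
have single j : (j < m)%N -> exists x, P (3 * j)%N = [set x]%SET.
  by move=> /card_period[/eqP/finset.cards1P].
have [x0 _] := single 0%N m_gt0.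
have ex j : exists x, (j < m)%N -> P (3 * j)%N = [set x]%SET.
  by case: (ltnP j m) => [/single[x Px]|_]; [exists x|exists x0].
by have [u uP] := choice ex; exists u.
Qed.

Section Layers.
Variable f : 'I_n -> R.
Variable u : nat -> 'I_n.
Hypothesis uP : forall j, (j < m)%N -> P (3 * j)%N = [set u j]%SET.

(** Energy of the edges between the cut vertex [u j] and the next one; the last period has no next
    cut vertex. *)
Definition layer_energy j : R :=
  \sum_(x in P (3 * j).+1) (f (u j) - f x) ^+ 2 +
  \sum_(x in P (3 * j).+1) \sum_(y in P (3 * j).+2) (f x - f y) ^+ 2 +
  (if (j.+1 < m)%N then \sum_(y in P (3 * j).+2) (f y - f (u j.+1)) ^+ 2 else 0).

Lemma layer_energy_sum : \sum_(0 <= j < m) layer_energy j <= energy G f.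
Proof.
apply: le_trans (seq_join_energy f join).
pose q i := if (i.+1 < 3 * m)%N then
  \sum_(x in P i) \sum_(y in P i.+1) (f x - f y) ^+ 2 else 0.
have -> : \sum_(0 <= i < (3 * m).-1) \sum_(x in P i) \sum_(y in P i.+1) (f x - f y) ^+ 2 =
    \sum_(0 <= i < 3 * m) q i.
  have K0 : (0 < 3 * m)%N by rewrite muln_gt0.
  rewrite -[in RHS](prednK K0) big_nat_recr //= {2}/q prednK // ltnn addr0.
  rewrite big_nat [RHS]big_nat; apply: eq_bigr => i /andP[_ iK].
  by rewrite /q; case: ifP => //; lia.
rewrite sum_by_three big_nat [leRHS]big_nat; apply: ler_sum => j /andP[_ jm].
have i1 : ((3 * j).+1 < 3 * m)%N by lia.
have i2 : ((3 * j).+2 < 3 * m)%N by lia.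
rewrite /layer_energy /q i1 i2.
rewrite uP // big_set1 !lerD //.
case: ifP => j1; last by case: ifP => // _; apply: sumr_ge0 => x _; apply: sumr_ge0 => y _; exact: sqr_ge0.
rewrite ifT; last by lia.
have -> : (3 * j).+3 = (3 * j.+1)%N by lia.
by apply: ler_sum => x _; rewrite uP // big_set1.
Qed.

Lemma layer_energy_ge0 j : 0 <= layer_energy j.
Proof.
rewrite !addr_ge0 //; last by case: ifP => // _; apply: sumr_ge0 => x _; exact: sqr_ge0.
  by apply: sumr_ge0 => x _; exact: sqr_ge0.
by apply: sumr_ge0 => x _; apply: sumr_ge0 => y _; exact: sqr_ge0.
Qed.

Lemma layer1_bound j x : x \in P (3 * j).+1 -> (f x - f (u j)) ^+ 2 <= layer_energy j.
Proof.
move=> xP; rewrite -(sqrrN (f x - _)) opprB /layer_energy (bigD1 x xP) /= -!addrA lerDl.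
rewrite !addr_ge0 //; last by case: ifP => // _; apply: sumr_ge0 => y _; exact: sqr_ge0.
  by apply: sumr_ge0 => y _; exact: sqr_ge0.
by apply: sumr_ge0 => z _; apply: sumr_ge0 => y _; exact: sqr_ge0.
Qed.

(** Two edges lead from [u j] to [y] through any vertex of the layer between them, whence the factor
    2. *)
Lemma layer2_bound j y : (j < m)%N -> y \in P (3 * j).+2 ->
  (f y - f (u j)) ^+ 2 <= 2 * layer_energy j.
Proof.
move=> jm yP; have [_ c1 _] := card_period jm; have [p1 _ _ _] := pattern12 d3.
have /card_gt0P[x xP] : (0 < #|P (3 * j).+1|)%N by rewrite c1.
have le : (f (u j) - f x) ^+ 2 + (f x - f y) ^+ 2 <= layer_energy j.
  rewrite /layer_energy -[leLHS]addr0; apply: lerD; last by case: ifP => // _; apply: sumr_ge0 => z _; exact: sqr_ge0.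
  apply: lerD.
    by rewrite (bigD1 x xP) /= lerDl; apply: sumr_ge0 => z _; exact: sqr_ge0.
  rewrite (bigD1 x xP) /= (bigD1 y yP) /= -addrA lerDl addr_ge0 //.
    by apply: sumr_ge0 => z _; exact: sqr_ge0.
  by apply: sumr_ge0 => z _; apply: sumr_ge0 => t _; exact: sqr_ge0.
apply: le_trans (ler_wpM2l _ le) => //.
have := sqr_ge0 (f (u j) - f x - (f x - f y)).
by move: (f (u j)) (f x) (f y) => a b c; nra.
Qed.

Lemma center_step j : (j.+1 < m)%N ->
  (pattern d 1 * pattern d 2)%:R * (f (u j.+1) - f (u j)) ^+ 2 <=
    d.+1%:R * layer_energy j.
Proof.
move=> j1; have jm := ltnW j1; have [_ c1 c2] := card_period jm.
have [_ _ p12 _] := pattern12 d3.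
have := join_chain_bound (P (3 * j).+1) (P (3 * j).+2) f (f (u j)) (f (u j.+1)).
rewrite c1 c2 -natrM /layer_energy j1 -(natrD _ 1) -natrD -addnA p12 add1n.
by [].
Qed.

End Layers.

Hypothesis Gconn : Defs.connected G.
Hypothesis exitA : forall x y, x \in M -> y \in A -> G x y -> x \in P 0%N.
Hypothesis exitB : forall x y, x \in M -> y \in B -> G x y -> x \in P (3 * m).-1.
Hypothesis noAB : forall x y, x \in A -> y \in B -> ~~ G x y.

Lemma layer_in_M i x : (i < 3 * m)%N -> x \in P i -> x \in M.
Proof.
by case: join => -> _ _ _ iK xP; apply/finset.bigcupP; exists (Ordinal iK).
Qed.

Lemma in_cover x : [|| x \in A, x \in M | x \in B].
Proof. by have := finset.in_setT x; rewrite -cover !inE orbA. Qed.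

(* Compare [f] with the function equal, on each period and on the adjacent end
   piece, to the value of [f] at the cut vertex [u j] of that period: the error is
   [O(energy)], and the latter function lives on a path with [d.+1] vertices per
   step and resistance [d.+1 / (p1 * p2)] per step. *)
Lemma decomposition_poincare (C2 : nat) (eps : R)
    (lam := 2 - 2 * cos (angle R (#|A| + m + #|B|))) :
  (#|A| + #|B| <= C2)%N -> 0 < eps -> 0 < lam ->
  poincare G ((1 + eps) * (d.+1%:R ^+ 2 / (pattern d 1 * pattern d 2)%:R / lam) +
    (1 + eps^-1) * (2 * d%:R + 3 * C2%:R ^+ 3 + 4 * C2%:R)).
Proof.
move=> ABC e0 lam0 f f0; set E := energy G f.
have lt3 j : (j < m)%N -> (3 * j < 3 * m)%N by lia.
have m1 : (m.-1 < m)%N by rewrite prednK.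
have jm1 j : (j < m.-1)%N -> (j.+1 < m)%N by lia.
have last_layer : (3 * m).-1 = (3 * m.-1).+2 by lia.
have E0 : 0 <= E := energy_ge0 G f.
have [u uP] := centers; pose h j := f (u j).
have [c cP] := padded_wirtinger (fun j => h j) m_gt0 lam0.
apply: le_trans (variance_min c f0) _.
have [p1 p2 p12 _] := pattern12 d3.
have eV0 : 0 < eps^-1 by rewrite invr_gt0.
have e1 : 0 <= 1 + eps by rewrite addr_ge0 ?ltW.
have eV1 : 0 <= 1 + eps^-1 by rewrite addr_ge0 ?ltW.
pose Q := layer_energy f u.
have Qsum : \sum_(0 <= j < m) Q j <= E := layer_energy_sum f uP.
have Q0 j : 0 <= Q j := layer_energy_ge0 f u j.
have QE j : (j < m)%N -> Q j <= E.
  move=> jm; apply: le_trans Qsum; rewrite big_mkord (bigD1 (Ordinal jm)) //= lerDl.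
  by apply: sumr_ge0 => i _; exact: Q0.
have AC : #|A|%:R <= C2%:R :> R by rewrite ler_nat (leq_trans (leq_addr _ _) ABC).
have BC : #|B|%:R <= C2%:R :> R by rewrite ler_nat (leq_trans (leq_addl _ _) ABC).
have uM j : (j < m)%N -> u j \in M.
  by move=> jm; apply: (@layer_in_M (3 * j)); [exact: lt3|rewrite uP // finset.set11].
have split x t (r : R) : (f x - t) ^+ 2 <= r ->
    (f x - c) ^+ 2 <= (1 + eps) * (t - c) ^+ 2 + (1 + eps^-1) * r.
  move=> xr; have -> : f x - c = (t - c) + (f x - t) by ring.
  by apply: le_trans (sqr_split _ _ e0) _; rewrite lerD2l ler_wpM2l.
have Abound : \sum_(x in A) (f x - c) ^+ 2 <=
    #|A|%:R * ((1 + eps) * (h 0%N - c) ^+ 2 + (1 + eps^-1) * (C2%:R ^+ 2 * E)).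
  rewrite mulr_natl -sumr_const; apply: ler_sum => x xA; apply: split.
  have u0A : u 0%N \notin A by rewrite (disjointFl disAM) // uM.
  have [|w wP fw] := @exit_bound R n G A (P 0%N) f x (u 0%N) Gconn xA u0A.
    move=> y z yA zA yz; have := in_cover z; rewrite (negPf zA) /=.
    case/orP => [zM|zB]; first by apply: exitA zM yA _; rewrite adj_sym.
    by have := noAB yA zB; rewrite yz.
  have -> : h 0%N = f w by move: wP; rewrite -[0%N]/(3 * 0)%N uP // => /finset.set1P ->.
  by apply: le_trans fw _; rewrite ler_wpM2r // ler_sqr ?nnegrE.
have Bbound : \sum_(x in B) (f x - c) ^+ 2 <= #|B|%:R *
    ((1 + eps) * (h m.-1 - c) ^+ 2 + (1 + eps^-1) * ((2 * C2%:R ^+ 2 + 4) * E)).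
  rewrite mulr_natl -sumr_const; apply: ler_sum => x xB; apply: split.
  have u0B : u 0%N \notin B by rewrite (disjointFr disMB) // uM.
  have [|w wP fw] := @exit_bound R n G B (P (3 * m).-1) f x (u 0%N) Gconn xB u0B.
    move=> y z yB zB yz; have := in_cover z; rewrite (negPf zB) orbF.
    case/orP => [zA|zM]; last by apply: exitB zM yB _; rewrite adj_sym.
    by have := noAB zA yB; rewrite adj_sym yz.
  have wP' : w \in P (3 * m.-1).+2 by rewrite -last_layer.
  have := layer2_bound f u m1 wP'; rewrite -/(Q m.-1) -/(h m.-1).
  have := QE _ m1.
  have : #|B|%:R ^+ 2 * E <= C2%:R ^+ 2 * E by rewrite ler_wpM2r // ler_sqr ?nnegrE.
  (* The exit vertex [w] of [B] lies two edges away from the last cut vertex, whereas the exit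
     vertex of [A] is [u 0] itself; this explains the larger constant for [B]. *)
  have : (f x - h m.-1) ^+ 2 <= 2 * (f x - f w) ^+ 2 + 2 * (f w - h m.-1) ^+ 2.
    have := sqr_ge0 (f x - f w - (f w - h m.-1)).
    by move: (f x) (f w) (h m.-1) => r s t; nra.
  have -> : (2 * C2%:R ^+ 2 + 4) * E = 2 * (C2%:R ^+ 2 * E) + 4 * E by ring.
  move: fw; rewrite -/E.
  move: (#|B|%:R ^+ 2 * E) (C2%:R ^+ 2 * E) ((f x - h m.-1) ^+ 2) ((f x - f w) ^+ 2)
    ((f w - h m.-1) ^+ 2) (Q m.-1) => *; lra.
have Mbound : \sum_(0 <= j < m) (\sum_(x in P (3 * j)%N) (f x - c) ^+ 2 +
      \sum_(x in P (3 * j).+1) (f x - c) ^+ 2 + \sum_(x in P (3 * j).+2) (f x - c) ^+ 2) <=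
   (1 + eps) * d.+1%:R * \sum_(0 <= j < m) (h j - c) ^+ 2 +
   (1 + eps^-1) * (2 * d%:R * E).
  apply: (@le_trans _ _ (\sum_(0 <= j < m) ((1 + eps) * d.+1%:R * (h j - c) ^+ 2 +
      (1 + eps^-1) * (2 * d%:R) * Q j))); last first.
    rewrite big_split /= -!mulr_sumr lerD2l -[leLHS]mulrA.
    by rewrite ler_wpM2l // ler_wpM2l // mulr_ge0.
  rewrite big_nat [leRHS]big_nat; apply: ler_sum => j /andP[_ jm].
  have [_ c1 c2] := card_period jm.
  have s0 : \sum_(x in P (3 * j)%N) (f x - c) ^+ 2 <= (1 + eps) * (h j - c) ^+ 2.
    by rewrite uP // big_set1 -[leLHS]mul1r ler_wpM2r ?sqr_ge0 // lerDl ltW.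
  have s1 : \sum_(x in P (3 * j).+1) (f x - c) ^+ 2 <=
      (pattern d 1)%:R * ((1 + eps) * (h j - c) ^+ 2 + (1 + eps^-1) * (2 * Q j)).
    rewrite -c1 mulr_natl -sumr_const; apply: ler_sum => x xP; apply: split.
    apply: le_trans (layer1_bound f u xP) _; rewrite -/(Q j).
    by have := Q0 j; lra.
  have s2 : \sum_(x in P (3 * j).+2) (f x - c) ^+ 2 <=
      (pattern d 2)%:R * ((1 + eps) * (h j - c) ^+ 2 + (1 + eps^-1) * (2 * Q j)).
    rewrite -c2 mulr_natl -sumr_const; apply: ler_sum => x xP; apply: split.
    exact: layer2_bound.
  apply: le_trans (lerD (lerD s0 s1) s2) _.
  rewrite le_eqVlt; apply/orP; left; apply/eqP.
  have dE : d%:R = (pattern d 1)%:R + (pattern d 2)%:R :> R by rewrite -natrD p12.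
  by rewrite -(@natr1 R d) dE; ring.
rewrite (sum_vertices (fun x => (f x - c) ^+ 2)).
apply: le_trans (lerD (lerD Abound Bbound) Mbound) _.
(* In [d.+1 * Z] a vertex of [A] or [B] weighs as much as a whole period. The price of this
   overcount is a path longer by at most [C2] steps. *)
set Z := #|A|%:R * (h 0%N - c) ^+ 2 + \sum_(0 <= j < m) (h j - c) ^+ 2 +
         #|B|%:R * (h m.-1 - c) ^+ 2 in cP.
have pp0 : 0 < (pattern d 1 * pattern d 2)%:R :> R by rewrite ltr0n muln_gt0 p1.
have Zle : Z <= d.+1%:R / (pattern d 1 * pattern d 2)%:R / lam * E.
  rewrite mulrAC ler_pdivlMr // mulrC; apply: le_trans cP _.
  rewrite mulrAC ler_pdivlMr // mulrC mulr_sumr.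
  apply: (@le_trans _ _ (\sum_(0 <= j < m.-1) d.+1%:R * Q j)).
    rewrite big_nat [leRHS]big_nat; apply: ler_sum => j /andP[_ jm].
    by apply: center_step => //; exact: jm1.
  rewrite -mulr_sumr ler_wpM2l //; apply: le_trans Qsum.
  by rewrite -[in leRHS](prednK m_gt0) big_nat_recr //= lerDl Q0.
apply: (@le_trans _ _ ((1 + eps) * (d.+1%:R * Z) +
    (1 + eps^-1) * ((2 * d%:R + 3 * C2%:R ^+ 3 + 4 * C2%:R) * E))); last first.
  rewrite [leRHS]mulrDl lerD //; last by rewrite mulrA.
  rewrite -mulrA ler_wpM2l //.
  have -> : d.+1%:R ^+ 2 / (pattern d 1 * pattern d 2)%:R / lam * E =
     d.+1%:R * (d.+1%:R / (pattern d 1 * pattern d 2)%:R / lam * E) by ring.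
  by rewrite ler_wpM2l.
have H0 : 0 <= (h 0%N - c) ^+ 2 by exact: sqr_ge0.
have Hm : 0 <= (h m.-1 - c) ^+ 2 by exact: sqr_ge0.
have dA : #|A|%:R * (h 0%N - c) ^+ 2 <= d.+1%:R * (#|A|%:R * (h 0%N - c) ^+ 2).
  by apply: (ler_peMl (mulr_ge0 (ler0n _ _) H0)); rewrite (ler_nat R 1).
have dB : #|B|%:R * (h m.-1 - c) ^+ 2 <= d.+1%:R * (#|B|%:R * (h m.-1 - c) ^+ 2).
  by apply: (ler_peMl (mulr_ge0 (ler0n _ _) Hm)); rewrite (ler_nat R 1).
have tA : #|A|%:R * (C2%:R ^+ 2 * E) <= C2%:R ^+ 3 * E.
  have -> : C2%:R ^+ 3 * E = C2%:R * (C2%:R ^+ 2 * E) by rewrite exprS mulrA.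
  exact: (ler_wpM2r (mulr_ge0 (sqr_ge0 _) E0) AC).
have tB : #|B|%:R * ((2 * C2%:R ^+ 2 + 4) * E) <= (2 * C2%:R ^+ 3 + 4 * C2%:R) * E.
  have -> : (2 * C2%:R ^+ 3 + 4 * C2%:R) * E = C2%:R * ((2 * C2%:R ^+ 2 + 4) * E) by ring.
  apply: (ler_wpM2r _ BC); apply: mulr_ge0 E0.
  by rewrite addr_ge0 // mulr_ge0 // sqr_ge0.
have part1 : (1 + eps) * (#|A|%:R * (h 0%N - c) ^+ 2 + #|B|%:R * (h m.-1 - c) ^+ 2 +
    d.+1%:R * \sum_(0 <= j < m) (h j - c) ^+ 2) <= (1 + eps) * (d.+1%:R * Z).
  rewrite ler_wpM2l // /Z !mulrDr.
  by rewrite addrAC lerD // lerD.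
have part2 : (1 + eps^-1) * (#|A|%:R * (C2%:R ^+ 2 * E) +
    #|B|%:R * ((2 * C2%:R ^+ 2 + 4) * E) + 2 * d%:R * E) <=
    (1 + eps^-1) * ((2 * d%:R + 3 * C2%:R ^+ 3 + 4 * C2%:R) * E).
  rewrite ler_wpM2l //; apply: le_trans (lerD (lerD tA tB) (lexx _)) _.
  by rewrite le_eqVlt; apply/orP; left; apply/eqP; ring.
apply: le_trans (lerD part1 part2).
by rewrite le_eqVlt; apply/orP; left; apply/eqP; ring.
Qed.

End Decomposition.

End PatternedPoincare.

(** * Upper bound *)

Section MinimalGraphs.
Variable R : realType.

Lemma sgraph_eq n (G H : sgraph n) : G =2 H -> G = H.
Proof.
case: G H => [g g_sym g_irr] [h h_sym h_irr] /= gh.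
have gE : g = h by apply: funext => x; apply: funext => y.
by rewrite gE in g_sym g_irr *; congr SGraph; exact: Prop_irrelevance.
Qed.

(** Codes graphs by elements of a finite type, over which a minimum exists; symmetrising and
    removing loops makes every function a valid code. *)
Definition graph_of n (c : {ffun 'I_n * 'I_n -> bool}) : rel 'I_n :=
  fun x y => (x != y) && (c (x, y) || c (y, x)).

Lemma graph_of_sym n c : symmetric (@graph_of n c).
Proof. by move=> x y; rewrite /graph_of eq_sym orbC. Qed.

Lemma graph_of_irr n c : irreflexive (@graph_of n c).
Proof. by move=> x; rewrite /graph_of eqxx. Qed.

Definition sgraph_of n c := SGraph (@graph_of_sym n c) (@graph_of_irr n c).

Lemma sgraph_of_surj n (G : sgraph n) : exists c, G = sgraph_of c.
Proof.
exists [ffun p => G p.1 p.2]; apply: sgraph_eq => x y /=.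
rewrite /graph_of !ffunE /= (adj_sym G y) orbb.
by case: eqVneq => // ->; rewrite adj_irr.
Qed.

Lemma exists_extremal_graph n (Q : sgraph n -> Prop) (F : sgraph n -> R) (G0 : sgraph n) :
  Q G0 -> exists2 G, Q G & forall H, Q H -> F G <= F H.
Proof.
have [c0 ->] := sgraph_of_surj G0 => Qc0.
pose p c := `[< Q (sgraph_of c) >].
have pc0 : p c0 by apply/asboolP.
case: (arg_minP (fun c => F (sgraph_of c)) pc0) => c /asboolP Qc cmin.
exists (sgraph_of c) => // H; have [c' ->] := sgraph_of_surj H => Qc'.
by apply: cmin; apply/asboolP.
Qed.

Lemma exists_mu_minimal d n (G0 : sgraph n) :
  Defs.connected G0 -> regular G0 d -> exists G : sgraph n, mu_minimal R d G.
Proof.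
move=> conn reg.
have [G [Gconn Greg] Gmin] := @exists_extremal_graph n
  (fun G => Defs.connected G /\ regular G d) (@alg_connectivity R n) G0 (conj conn reg).
by exists G; split => // H Hconn Hreg; exact: Gmin.
Qed.

(** By finiteness the set of relaxation times has a largest element, so [xget] does not return its
    default. *)
Lemma max_relaxation_time_ge n (G : sgraph n) d : Defs.connected G -> regular G d ->
  relaxation_time R G <= max_relaxation_time R n.
Proof.
move=> conn reg.
have [H [Hconn Hreg] Hmax] := @exists_extremal_graph n
  (fun G => Defs.connected G /\ exists d, regular G d)
  (fun G => - relaxation_time R G) G (conj conn (ex_intro _ d reg)).
have in_max : (@relaxation_times R n `&` ubound (@relaxation_times R n))%classic
    (relaxation_time R H).
  split; first by exists H.
  move=> t [H' [H'conn H'reg ->]]; rewrite -lerN2; exact: Hmax.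
rewrite /max_relaxation_time; case: xgetP => [t _ [_ ub]|no].
  by apply: ub; exists G; split => //; exists d.
by have := no _ in_max.
Qed.

(** The condition [0 <= b] accounts for the default value of [xget]. *)
Lemma max_relaxation_time_le n (b : R) : 0 <= b ->
  (forall (G : sgraph n) d, Defs.connected G -> regular G d -> relaxation_time R G <= b) ->
  max_relaxation_time R n <= b.
Proof.
move=> b0 bP; rewrite /max_relaxation_time; case: xgetP => [t _ [[G [conn [d reg] ->]] _]|_] //.
exact: bP conn reg.
Qed.

End MinimalGraphs.

Section UpperBound.
Variable R : realType.

Lemma aldous_fill_value_ge0 n : 0 <= aldous_fill_value R n.
Proof. by rewrite divr_ge0 ?mulr_ge0 ?exprn_ge0 ?pi_ge0. Qed.

(** The conclusion is a Poincare constant, since it has to pass through [alg_connectivity] from a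
    mu-minimal graph to its competitors. *)
Lemma patterned_poincare d C2 (e : R) : (3 <= d)%N -> 0 < e ->
  exists N0 : nat, forall n (G : sgraph n), (N0 <= n)%N -> Defs.connected G ->
    patterned G d C2 ->
    exists2 K, 0 < K & poincare G K /\ d%:R * K <= (1 + e) * aldous_fill_value R n.
Proof.
move=> d3 e_gt0; have [p1 p2 _ pp] := pattern12 d3.
set pq := (pattern d 1 * pattern d 2)%N in pp *.
have pq0 : 0 < pq%:R :> R by rewrite ltr0n muln_gt0 p1.
(* For [eps <= 1] the final factor [(1 + eps) ^+ 3 + eps] is at most [1 + 8 * eps]. *)
pose eps : R := Num.min e 1 / 8.
have eps0 : 0 < eps by rewrite divr_gt0 // lt_min e_gt0 ltr01.
have eps_e : 8 * eps <= e by rewrite /eps mulrC divfK // ge_min lexx.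
have eps_1 : eps <= 1 by have : Num.min e 1 <= 1; [rewrite ge_min lexx orbT|rewrite /eps; lra].
clearbody eps.
pose C' : R := 2 * d%:R + 3 * C2%:R ^+ 3 + 4 * C2%:R.
pose D : R := d%:R * ((1 + eps^-1) * C').
pose w : R := d.+1%:R.
(* From the summands: [N] is large enough for the cosine estimate, the end pieces lengthen the path
   by a factor of at most [1 + eps / 3], the additive error [D] is at most [eps] times the target,
   and [n >= 2]. *)
pose T : R := 2 * w / eps + 3 * w * C2%:R / eps + 8 * D / eps + 2.
exists (Num.truncn T).+1 => n G nT conn [A [M [B [m [P]]]]].
case=> [[cover disAM disAB disMB] ABC [m0 join _ cardP] [exA exB] noAB].
have Tn : T <= n%:R.
  by apply: le_trans (ltW (truncnS_gt T)) _; rewrite ler_nat.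
have w0 : 0 < w by [].
have C'0 : 0 <= C' by rewrite !addr_ge0 ?mulr_ge0 ?exprn_ge0.
have D0 : 0 <= D.
  by apply: mulr_ge0 => //; apply: mulr_ge0 => //; rewrite addr_ge0 // invr_ge0 ltW.
have nV : n%:R = #|A|%:R + #|B|%:R + m%:R * w :> R.
  exact: (card_vertices R d3 cover disAM disAB disMB join cardP).
pose N := (#|A| + m + #|B|)%N.
have N0 : (0 < N)%N by rewrite /N addn_gt0 addn_gt0 m0 orbT.
have N0' : 0 < N%:R :> R by rewrite ltr0n.
have w1 : 1 <= w by rewrite (ler_nat R 1).
have wN : w * N%:R = n%:R + (w - 1) * (#|A|%:R + #|B|%:R).
  by rewrite nV /N !natrD; ring.
have AB0 : 0 <= #|A|%:R + #|B|%:R :> R by rewrite addr_ge0.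
have ABC' : #|A|%:R + #|B|%:R <= C2%:R :> R by rewrite -natrD ler_nat.
have terms : [/\ 0 <= 2 * w / eps, 0 <= 3 * w * C2%:R / eps & 0 <= 8 * D / eps].
  split; apply: divr_ge0 (ltW eps0) => //.
  - exact: mulr_ge0 (ler0n _ _) (ltW w0).
  - exact: mulr_ge0 (mulr_ge0 (ler0n _ _) (ltW w0)) (ler0n _ _).
  - exact: mulr_ge0 (ler0n _ _) D0.
have n2 : 2 <= n%:R :> R by case: terms; move: Tn; rewrite /T; lra.
have n_w : 2 * w <= eps * n%:R.
  by rewrite [leRHS]mulrC -ler_pdivrMr //; case: terms; move: Tn; rewrite /T; lra.
have n_C : 3 * (w * C2%:R) <= eps * n%:R.
  by rewrite mulrA [leRHS]mulrC -ler_pdivrMr //; case: terms; move: Tn; rewrite /T; lra.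
have n_D : 8 * D <= eps * n%:R.
  by rewrite [leRHS]mulrC -ler_pdivrMr //; case: terms; move: Tn; rewrite /T; lra.
have wN_ge : n%:R <= w * N%:R by rewrite wN lerDl mulr_ge0 // subr_ge0.
have wN_le : w * N%:R <= n%:R + w * C2%:R.
  by rewrite wN lerD2l; apply: ler_pM => //; [rewrite subr_ge0|rewrite lerBlDr lerDl].
set lam := 2 - 2 * cos (angle R N).
pose a := angle R N ^+ 2.
have a0 : 0 < a by rewrite exprn_gt0 // divr_gt0 // pi_gt0.
have t_le : N%:R ^- 2 <= eps / 2.
  have N1 : 1 <= N%:R :> R by rewrite (ler_nat R 1).
  apply: (@le_trans _ _ (N%:R^-1)).
    by rewrite lef_pV2 ?posrE ?exprn_gt0 // expr2 ler_peMl.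
  by rewrite -[leLHS]mul1r ler_pdivrMr //; move: n_w wN_ge; nra.
have lam_ge : a <= (1 + eps) * lam.
  have := @eigenvalue_path_ge R N N0; rewrite -/a -/lam => lam_ge.
  apply: le_trans (ler_wpM2l (_ : 0 <= 1 + eps) lam_ge); last by rewrite addr_ge0 ?ltW.
  rewrite mulrCA -[leLHS]mulr1 ler_wpM2l ?(ltW a0) //.
  move: (N%:R ^- 2) t_le => t t_le; nra.
have lam0 : 0 < lam.
  by have := lt_le_trans a0 lam_ge; rewrite pmulr_rgt0 // addr_gt0.
pose K := (1 + eps) * (w ^+ 2 / pq%:R / lam) + (1 + eps^-1) * C'.
have poinc : poincare G K := decomposition_poincare d3 cover disAM disAB disMB m0 join
  cardP conn exA exB noAB ABC eps0 lam0.
have K1 : 0 < (1 + eps) * (w ^+ 2 / pq%:R / lam).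
  by rewrite !mulr_gt0 ?invr_gt0 ?exprn_gt0 // addr_gt0.
have K0 : 0 < K.
  by rewrite ltr_pwDl // mulr_ge0 // addr_ge0 ?invr_ge0 ?ltW.
exists K => //; split => //.
pose V := aldous_fill_value R n.
have pi0 : 0 < pi ^+ 2 :> R by rewrite exprn_gt0 // pi_gt0.
have part1 : d%:R * ((1 + eps) * (w ^+ 2 / pq%:R / lam)) <= (1 + eps) ^+ 3 * V.
  apply: (@le_trans _ _ ((1 + eps) ^+ 2 * (3 / 2) * (w ^+ 2 / a))).
    have -> : d%:R * ((1 + eps) * (w ^+ 2 / pq%:R / lam)) =
        (1 + eps) * (d%:R / pq%:R) * w ^+ 2 * lam^-1 by ring.
    have -> : (1 + eps) ^+ 2 * (3 / 2) * (w ^+ 2 / a) =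
        (1 + eps) * (3 / 2) * w ^+ 2 * ((1 + eps) / a) by ring.
    apply: ler_pM; rewrite ?invr_ge0 ?(ltW lam0) //.
    - by rewrite !mulr_ge0 ?invr_ge0 ?sqr_ge0 // addr_ge0 // ltW.
    - rewrite ler_wpM2r ?sqr_ge0 // ler_wpM2l ?addr_ge0 ?(ltW eps0) //.
      rewrite ler_pdivrMr // mulrAC ler_pdivlMr // -!natrM ler_nat mulnC //.
    - by rewrite ler_pdivlMr // mulrC ler_pdivrMr.
  have -> : w ^+ 2 / a = (w * N%:R) ^+ 2 / pi ^+ 2.
    rewrite /a /angle !exprMn exprVn; move: (pi ^+ 2) pi0 => p p0.
    by field; rewrite !gt_eqF.
  have -> : (1 + eps) ^+ 3 * V = (1 + eps) ^+ 2 * (3 / 2) * ((1 + eps) * n%:R ^+ 2 / pi ^+ 2).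
    rewrite /V /aldous_fill_value; move: (pi ^+ 2) pi0 => p p0.
    by field; rewrite gt_eqF.
  have c0 : 0 <= (1 + eps) ^+ 2 * (3 / 2) by rewrite mulr_ge0 ?sqr_ge0 ?divr_ge0.
  apply: (ler_wpM2l c0); rewrite ler_wpM2r ?invr_ge0 ?(ltW pi0) //.
  apply: (@le_trans _ _ ((n%:R + eps * n%:R / 3) ^+ 2)).
    rewrite ler_sqr ?nnegrE ?addr_ge0 ?mulr_ge0 ?invr_ge0 ?(ltW w0) ?(ltW eps0) //.
    by apply: le_trans wN_le _; rewrite lerD2l ler_pdivlMr // mulrC.
  have -> : (n%:R + eps * n%:R / 3) ^+ 2 = (1 + eps / 3) ^+ 2 * n%:R ^+ 2 by field.
  by rewrite ler_wpM2r ?sqr_ge0 //; nra.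
have part2 : D <= eps * V.
  have := aldous_fill_value_ge R n; rewrite -/V => V_ge.
  apply: (@le_trans _ _ (eps * (n%:R ^+ 2 / 8))); last by rewrite ler_wpM2l // ltW.
  rewrite mulrA ler_pdivlMr // mulrC; apply: le_trans n_D _.
  by rewrite ler_wpM2l ?(ltW eps0) // expr2 ler_peMl //; lra.
rewrite /K mulrDr -/D.
apply: le_trans (lerD part1 part2) _; rewrite -mulrDl ler_wpM2r ?aldous_fill_value_ge0 //.
have -> : (1 + eps) ^+ 3 = 1 + 3 * eps + 3 * eps ^+ 2 + eps ^+ 3 by ring.
have : eps ^+ 2 <= eps by rewrite expr2 ler_piMl // ltW.
have : eps ^+ 3 <= eps ^+ 2 by rewrite exprS ler_piMl // sqr_ge0.
lra.
Qed.

Lemma relaxation_upper (H : mu_minimal_structure R) (e : R) : 0 < e ->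
  exists N0 : nat, forall n d (G : sgraph n), (N0 <= n)%N -> Defs.connected G ->
    regular G d -> relaxation_time R G <= (1 + e) * aldous_fill_value R n.
Proof.
move=> e0; have [D largeD] := relaxation_le_large R.
have V_le n : aldous_fill_value R n <= (1 + e) * aldous_fill_value R n.
  by rewrite ler_peMl ?aldous_fill_value_ge0 // lerDl ltW.
have each d : exists N0 : nat, forall n (G : sgraph n), (N0 <= n)%N ->
    Defs.connected G -> regular G d ->
    relaxation_time R G <= (1 + e) * aldous_fill_value R n.
  have [d3|d3] := leqP 3 d.
    have [C1 [C2 struct]] := H d d3.
    have [N0 N0P] := patterned_poincare C2 d3 e0.
    exists (maxn 2 (maxn C1 N0)) => n G; rewrite !geq_max => /and3P[n2 nC nN] conn reg.
    have [G0 G0min] := exists_mu_minimal R conn reg.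
    have [_ pat] := struct n G0 nC G0min; have [G0conn G0reg G0le] := G0min.
    have [K K0 [GK dK]] := N0P n G0 nN G0conn pat.
    apply: le_trans dK; rewrite (relaxation_timeE _ n2 _ reg); last by apply: leq_trans d3.
    have mu_ge := le_trans (alg_connectivity_ge n2 K0 GK) (G0le G conn reg).
    have mu0 : 0 < alg_connectivity R G by apply: lt_le_trans mu_ge; rewrite invr_gt0.
    by rewrite ler_wpM2l // invf_ple ?posrE.
  exists 2%N => n G n2 conn reg; have [d0|d_gt0] := posnP d.
    pose x : 'I_n := Ordinal (ltnW n2); pose y : 'I_n := Ordinal n2.
    have [|] := connected_exit (A := [set x]%SET) (z := y) conn (finset.set11 x).
      by rewrite finset.in_set1; apply/eqP => /(congr1 val).
    move=> u [v [_ _ uv]]; have := reg u; rewrite d0 => /eqP.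
    by rewrite cards_eq0 => /eqP/setP/(_ v); rewrite !inE uv.
  apply: le_trans (V_le n); apply: le_trans (aldous_fill_value_ge R n).
  by apply: relaxation_le_small reg _; rewrite ?d_gt0.
have upto k : exists N0 : nat, forall d n (G : sgraph n), (d < k)%N -> (N0 <= n)%N ->
    Defs.connected G -> regular G d ->
    relaxation_time R G <= (1 + e) * aldous_fill_value R n.
  elim: k => [|k [N1 N1P]]; first by exists 0%N.
  have [N2 N2P] := each k; exists (maxn N1 N2) => d n G; rewrite ltnS leq_eqVlt geq_max.
  by case/predU1P => [-> /andP[_ nN2]|dk /andP[nN1 _]]; [exact: N2P|exact: N1P].
have [N1 N1P] := upto D; exists (maxn 2 N1) => n d G; rewrite geq_max => /andP[n2 nN1] conn reg.
have [dD|Dd] := ltnP d D; first exact: N1P reg.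
by apply: le_trans (V_le n); apply: largeD reg.
Qed.

End UpperBound.

(** * Lower bound *)

Section CubicGraphs.
Variables (k n' : nat).
Hypothesis k2 : (2 <= k)%N.
Hypothesis nE : k.*2 = n'.+1.

Let shift1 : 'I_n'.+1 := inord 1.
Let half : 'I_n'.+1 := inord k.

Let val1 : val shift1 = 1%N.
Proof. by rewrite /= inordK //; lia. Qed.

Let valk : val half = k.
Proof. by rewrite /= inordK //; lia. Qed.

Let valN (x : 'I_n'.+1) : val (- x) = ((n'.+1 - x) %% n'.+1)%N.
Proof. by []. Qed.

Let steps := [:: shift1; - shift1; half].

Let halfN : - half = half.
Proof.
apply: val_inj; rewrite valN /= valk -nE -addnn addnK modn_small //; lia.
Qed.

Let steps_uniq : uniq steps.
Proof.
have v1N : val (- shift1) = n' by rewrite valN val1 subn1 modn_small.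
rewrite /= !inE negb_or -!val_eqE v1N val1 valk andbT; apply/andP; split.
  by apply/andP; split; apply/eqP; lia.
by apply/eqP; lia.
Qed.

(** The Moebius ladder, a Cayley graph of Z / 2k with steps 1, -1 and k; the last is its own
    inverse, and [k >= 2] makes the three distinct. *)
Definition moebius_rel : rel 'I_n'.+1 := fun x y => y - x \in steps.

Lemma moebius_sym : symmetric moebius_rel.
Proof.
have opp_steps z : z \in steps -> - z \in steps.
  rewrite !inE => /or3P[] /eqP ->; rewrite ?opprK ?halfN ?eqxx ?orbT //.
by move=> x y; apply/idP/idP => /opp_steps; rewrite opprB.
Qed.

Lemma moebius_irr : irreflexive moebius_rel.
Proof.
move=> x; rewrite /moebius_rel subrr !inE -(inj_eq (@oppr_inj _)) oppr0.
rewrite -oppr0 (inj_eq (@oppr_inj _)) oppr0.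
have -> : (0 == shift1) = false by rewrite -val_eqE val1.
by rewrite -val_eqE valk; apply/eqP => /= ?; lia.
Qed.

Definition moebius := SGraph moebius_sym moebius_irr.

Lemma moebius_regular : regular moebius 3.
Proof.
move=> x; rewrite /deg -[3%N]/(size steps) -(card_uniqP steps_uniq).
rewrite -(card_imset (mem steps) (@addrI _ x)); apply: eq_card => y.
rewrite inE; apply/idP/imsetP => [yx|[z zs ->]].
  by exists (y - x); rewrite // addrC subrK.
by rewrite /= /moebius_rel addrC addKr.
Qed.

Lemma moebius_connected : Defs.connected moebius.
Proof.
apply/forall_inP => x _; apply/forall_inP => y _.
have walk j : connect [rel u v | [&& u \in [set: 'I_n'.+1]%SET, v \in [set: 'I_n'.+1]%SET
    & moebius u v]] x (x + shift1 *+ j).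
  elim: j => [|j IH]; first by rewrite mulr0n addr0 connect0.
  apply: connect_trans IH (connect1 _); rewrite /= !inE /= /moebius_rel.
  by rewrite mulrSr addrA (addrC _ shift1) addrK !inE eqxx.
have := walk (val (y - x)); congr connect.
have -> : shift1 *+ val (y - x) = y - x.
  apply: val_inj; rewrite Zp_mulrn; have -> : shift1 = 1%N :> nat by exact: val1.
  by rewrite mul1n /= modn_mod.
by rewrite addrC subrK.
Qed.

End CubicGraphs.

Lemma exists_cubic k : (2 <= k)%N ->
  exists G : sgraph k.*2, Defs.connected G /\ regular G 3.
Proof.
move=> k2; have [n' nE] : exists n', k.*2 = n'.+1 by exists k.*2.-1; lia.
rewrite nE; exists (moebius k2 nE).
by split; [exact: moebius_connected|exact: moebius_regular].
Qed.

(** * The cosine test function on a cubic chain *)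

Section TestFunction.
Variable R : realType.

Lemma sqr_split_ge (eps s t : R) : 0 < eps ->
  (1 - eps) * s ^+ 2 - eps^-1 * t ^+ 2 <= (s + t) ^+ 2.
Proof.
move=> e0; rewrite -subr_ge0.
have -> : (s + t) ^+ 2 - ((1 - eps) * s ^+ 2 - eps^-1 * t ^+ 2) =
    eps^-1 * (eps * s + t) ^+ 2 + t ^+ 2 by field; rewrite gt_eqF.
by rewrite addr_ge0 ?sqr_ge0 // mulr_ge0 ?sqr_ge0 ?invr_ge0 ?ltW.
Qed.

Section CosineSums.
Variable m : nat.
Hypothesis m2 : (2 <= m)%N.
Let theta := angle R m.

Definition cos_profile j : R := cos (theta / 2 + j%:R * theta).

Let m0 : 0 < m%:R :> R. Proof. by rewrite ltr0n; lia. Qed.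

Let theta_gt0 : 0 < theta. Proof. by rewrite divr_gt0 // pi_gt0. Qed.

Let m_theta : m%:R * theta = pi. Proof. by rewrite mulrC divfK // gt_eqF. Qed.

Let theta_lt_pi : theta < pi.
Proof.
have pi0 := @pi_gt0 R.
by rewrite /theta /angle ltr_pdivrMr // ltr_pMr // (ltr_nat R 1).
Qed.

Let sin_theta : sin theta != 0.
Proof. by rewrite gt_eqF // sin_gt0_pi // theta_gt0. Qed.

Let sin_half : sin (theta / 2) != 0.
Proof.
rewrite gt_eqF // sin_gt0_pi // divr_gt0 //=.
by move: theta_lt_pi theta_gt0; lra.
Qed.

Lemma cos_profile_sum : \sum_(0 <= j < m) cos_profile j = 0.
Proof.
apply: sum_cos => //; rewrite m_theta subrr sin0.
by rewrite (_ : _ - _ = pi) ?sinpi //; ring.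
Qed.

Lemma cos_profile_sqr : \sum_(0 <= j < m) cos_profile j ^+ 2 = m%:R / 2.
Proof.
have : \sum_(0 <= j < m) cos (theta + j%:R * (theta *+ 2)) = 0.
  have half2 : theta *+ 2 / 2 = theta by field.
  apply: sum_cos; rewrite half2 // subrr sin0.
  by rewrite mulrnAr m_theta addrAC subrr add0r sin2pi.
move=> c0; apply: (@mulIf _ 2) => //; rewrite divfK // mulr_suml.
transitivity (\sum_(0 <= j < m) (1 + cos (theta + j%:R * (theta *+ 2)))).
  apply: eq_bigr => j _.
  have -> : theta + j%:R * (theta *+ 2) = (theta / 2 + j%:R * theta) *+ 2 by field.
  by rewrite cos_mulr2n /cos_profile; ring.
by rewrite big_split /= c0 addr0 sumr_const_nat subn0.
Qed.

(** An increment is [-2 sin (theta / 2) sin ((j + 1) theta)], so the double-angle formula reduces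
    the sum to a vanishing sum of cosines. *)
Lemma cos_profile_increments :
  \sum_(0 <= j < m.-1) (cos_profile j.+1 - cos_profile j) ^+ 2 <=
    theta ^+ 2 * (m%:R / 2).
Proof.
have stepE j : (cos_profile j.+1 - cos_profile j) ^+ 2 =
    4 * sin (theta / 2) ^+ 2 * sin (j.+1%:R * theta) ^+ 2.
  rewrite /cos_profile; set b := j.+1%:R * theta.
  have -> : theta / 2 + b = b + theta / 2 by rewrite addrC.
  have -> : theta / 2 + j%:R * theta = b - theta / 2.
    by rewrite /b -(@natr1 R j); field.
  by rewrite cosD cosB; ring.
under eq_bigr do rewrite stepE.
rewrite -mulr_sumr.
have -> : \sum_(0 <= j < m.-1) sin (j.+1%:R * theta) ^+ 2 = m%:R / 2.
  have -> : \sum_(0 <= j < m.-1) sin (j.+1%:R * theta) ^+ 2 =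
      \sum_(0 <= j < m) sin (j%:R * theta) ^+ 2.
    have mE : m = m.-1.+1 by lia.
    by rewrite [in RHS]mE big_nat_recl //= mul0r sin0 expr0n add0r.
  have : \sum_(0 <= j < m) cos (0 + j%:R * (theta *+ 2)) = 0.
    have half2 : theta *+ 2 / 2 = theta by field.
    apply: sum_cos; rewrite half2 // !add0r.
    by rewrite mulrnAr m_theta addrC sinD2pi.
  move=> c0; apply: (@mulIf _ 2) => //; rewrite divfK // mulr_suml.
  transitivity (\sum_(0 <= j < m) (1 - cos (0 + j%:R * (theta *+ 2)))).
    apply: eq_bigr => j _; rewrite add0r.
    have -> : j%:R * (theta *+ 2) = (j%:R * theta) *+ 2 by rewrite mulrnAr.
    by rewrite cos_mulr2n sin2cos2; ring.
  by rewrite sumrB c0 subr0 sumr_const_nat subn0.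
rewrite ler_wpM2r ?divr_ge0 //.
have s0 : 0 <= sin (theta / 2).
  by rewrite sin_ge0_pi // divr_ge0 ?(ltW theta_gt0) //=; move: theta_lt_pi theta_gt0; lra.
have : sin (theta / 2) <= theta / 2 by rewrite sin_le // divr_ge0 ?(ltW theta_gt0).
by move: theta_gt0; nra.
Qed.

End CosineSums.

End TestFunction.

Section CubicTestFunction.
Variable R : realType.
Variables (n : nat) (G : sgraph n) (m : nat).
Variables (A M B : {set 'I_n}) (P : nat -> {set 'I_n}).
Hypothesis cover : (A :|: M :|: B = [set: 'I_n])%SET.
Hypotheses (disAM : [disjoint A & M]) (disAB : [disjoint A & B])
  (disMB : [disjoint M & B]).
Hypothesis m2 : (2 <= m)%N.
Hypothesis join : seq_join G M (3 * m) P.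
Hypothesis cardP : forall i, (i < 3 * m)%N -> #|P i| = pattern 3 i.
Hypothesis exitA : forall x y, x \in M -> y \in A -> G x y -> x \in P 0%N.
Hypothesis exitB : forall x y, x \in M -> y \in B -> G x y -> x \in P (3 * m).-1.
Hypothesis noAB : forall x y, x \in A -> y \in B -> ~~ G x y.

Let m0 : (0 < m)%N. Proof. exact: ltnW. Qed.

(** [A] and [B] join the first and the last layer, so that the edges inside them and those attaching
    them to [M] carry no energy. *)
Definition layer (x : 'I_n) : nat :=
  if x \in A then 0%N else if x \in B then (3 * m).-1
  else if [pick i : 'I_(3 * m) | x \in P i] is Some i then val i else 0%N.

Lemma layerA x : x \in A -> layer x = 0%N.
Proof. by rewrite /layer => ->. Qed.

Lemma layerB x : x \in B -> layer x = (3 * m).-1.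
Proof. by move=> xB; rewrite /layer (disjointFl disAB xB) xB. Qed.

Lemma layerP i x : (i < 3 * m)%N -> x \in P i -> layer x = i.
Proof.
move=> iK xi; have xM := layer_in_M join iK xi.
rewrite /layer (disjointFl disAM xM) (disjointFr disMB xM).
case: pickP => [j xj|/(_ (Ordinal iK))]; last by rewrite xi.
have [_ dis _ _] := join.
case: (ltngtP j i) => // ji.
  by have := @dis j i; rewrite ji iK => /(_ isT)/disjointFr/(_ xj); rewrite xi.
by have := @dis i j; rewrite ji ltn_ord => /(_ isT)/disjointFr/(_ xi); rewrite xj.
Qed.

Lemma in_layer x : x \in M -> exists2 i, (i < 3 * m)%N & x \in P i.
Proof. by case: join => -> _ _ _ /finset.bigcupP[i _ xi]; exists i. Qed.

(** Adjacent vertices lie in the same layer or in consecutive ones. Bounding each edge by the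
    symmetric sum [bnd] of layer indicators lets the double sum be counted layer by layer. *)
Lemma layered_energy_le (v : nat -> R) :
  energy G (fun x => v (layer x)) <=
    \sum_(0 <= i < (3 * m).-1) (#|P i| * #|P i.+1|)%:R * (v i.+1 - v i) ^+ 2.
Proof.
rewrite ler_pdivrMr //.
pose ind (X Y : {set 'I_n}) x y : R := ((x \in X) && (y \in Y))%:R.
have ind0 X Y x y : 0 <= ind X Y x y by exact: ler0n.
pose bnd x y := \sum_(0 <= i < (3 * m).-1)
  (ind (P i) (P i.+1) x y + ind (P i.+1) (P i) x y) * (v i.+1 - v i) ^+ 2.
have bnd_ge0 x y : 0 <= bnd x y.
  by apply: sumr_ge0 => i _; rewrite mulr_ge0 ?sqr_ge0 // addr_ge0.
have bndC x y : bnd x y = bnd y x.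
  by apply: eq_bigr => i _; rewrite addrC /ind; congr ((_%:R + _%:R) * _); rewrite andbC.
have le_bnd i x y : (i.+1 < 3 * m)%N -> x \in P i -> y \in P i.+1 ->
    (v i - v i.+1) ^+ 2 <= bnd x y.
  move=> iK xi yi; have iK' : (i < (3 * m).-1)%N by lia.
  rewrite /bnd big_mkord (bigD1 (Ordinal iK')) //= -[leLHS]addr0; apply: lerD.
    rewrite {1}/ind xi yi mulrDl mul1r -(sqrrN (v i - _)) opprB lerDl.
    by rewrite mulr_ge0 ?sqr_ge0.
  by apply: sumr_ge0 => j _; rewrite mulr_ge0 ?sqr_ge0 // addr_ge0.
apply: (@le_trans _ _ (\sum_x \sum_y bnd x y)).
  apply: ler_sum => x _; apply: ler_sum => y _.
  case: (boolP (G x y)) => Gxy; last by rewrite mul0r.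
  rewrite mul1r.
  have same : layer x = layer y -> (v (layer x) - v (layer y)) ^+ 2 <= bnd x y.
    by move=> ->; rewrite subrr expr0n.
  have Gyx : G y x by rewrite adj_sym.
  have K0 : (0 < 3 * m)%N by rewrite muln_gt0.
  have K1 : ((3 * m).-1 < 3 * m)%N by rewrite prednK.
  have := in_cover cover x; have := in_cover cover y.
  case/or3P => [yA|yM|yB]; case/or3P => [xA|xM|xB].
  - by apply: same; rewrite !layerA.
  - by apply: same; rewrite (layerA yA) (layerP K0 (exitA xM yA Gxy)).
  - by have := noAB yA xB; rewrite Gyx.
  - by apply: same; rewrite (layerA xA) (layerP K0 (exitA yM xA Gyx)).
  - have [i iK xi] := in_layer xM; have [j jK yj] := in_layer yM.
    rewrite (layerP iK xi) (layerP jK yj).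
    have [_ _ _ far] := join.
    case: (ltngtP i j) => [ij|ji|->]; last by rewrite subrr expr0n.
      have [jE|ij1] := eqVneq j i.+1.
        by rewrite jE in yj jK *; exact: le_bnd.
      have := far i j x y; rewrite Gxy ltn_neqAle eq_sym ij1 ij jK => /(_ isT xi yj).
      by [].
    have [iE|ji1] := eqVneq i j.+1.
      rewrite iE in xi iK *; rewrite bndC -(sqrrN (v _ - v _)) opprB; exact: le_bnd.
    have := far j i y x; rewrite Gyx ltn_neqAle eq_sym ji1 ji iK => /(_ isT yj xi).
    by [].
  - by apply: same; rewrite (layerB xB) (layerP K1 (exitB yM xB Gyx)).
  - by have := noAB xA yB; rewrite Gxy.
  - by apply: same; rewrite (layerB yB) (layerP K1 (exitB xM yB Gxy)).
  - by apply: same; rewrite !layerB.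
have ind_sum X Y : \sum_x \sum_y ind X Y x y = (#|X| * #|Y|)%:R.
  transitivity (\sum_(x in X) \sum_(y in Y) (1 : R)).
    rewrite [RHS]big_mkcond; apply: eq_bigr => x _; rewrite /ind.
    case: (x \in X) => /=; last by rewrite big1.
    by rewrite [RHS]big_mkcond; apply: eq_bigr => y _; case: (y \in Y).
  by under eq_bigr do rewrite sumr_const; rewrite sumr_const -mulrnA mulnC.
rewrite /bnd; under eq_bigr do rewrite exchange_big /=.
rewrite exchange_big /= mulr_suml; apply: ler_sum => i _.
under eq_bigr do rewrite -mulr_suml big_split /=.
rewrite -mulr_suml big_split /= !ind_sum [(#|P i.+1| * _)%N]mulnC.
by rewrite le_eqVlt; apply/orP; left; apply/eqP; ring.
Qed.

Let h j := cos_profile R m j.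
(** The last period has no successor to interpolate to, and the test function is constant on it. *)
Let g j : R := if (j.+1 < m)%N then h j.+1 - h j else 0.

(* Linear in the resistance: the three edges of a period have resistances
   1/2, 1/2 and 1. *)
Definition interpolation i : R :=
  h (i %/ 3) + g (i %/ 3) * nth 0 [:: 0; 1 / 4; 1 / 2] (i %% 3).

Let interp j r : (r < 3)%N ->
  interpolation (3 * j + r)%N = h j + g j * nth 0 [:: 0; 1 / 4; 1 / 2] r.
Proof.
by move=> r3; rewrite /interpolation mulnC divnMDl // divn_small // addn0 modnMDl modn_small.
Qed.

Let interp0 j : interpolation (3 * j)%N = h j.
Proof. by rewrite -[(3 * j)%N]addn0 interp //= mulr0 addr0. Qed.

Let interp1 j : interpolation (3 * j).+1 = h j + g j / 4.
Proof. by rewrite -addn1 interp //= mul1r. Qed.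

Let interp2 j : interpolation (3 * j).+2 = h j + g j / 2.
Proof. by rewrite -addn2 interp //= mul1r. Qed.

Let theta := angle R m.

Let sum_g : \sum_(0 <= j < m) g j ^+ 2 <= theta ^+ 2 * (m%:R / 2).
Proof.
apply: le_trans (cos_profile_increments R m2).
rewrite -[in leLHS](prednK m0) big_nat_recr //= {2}/g prednK // ltnn expr0n addr0.
rewrite big_nat [leRHS]big_nat; apply: ler_sum => j /andP[_ jm].
by rewrite /g ifT //; lia.
Qed.

(** A period has 4 vertices and [sum h^2 = m / 2], so the variance is about [2 m]; it has resistance
    2, so the energy is at most [sum g^2 / 2 <= theta^2 m / 4]. Hence mu is about [theta^2 / 8] at
    most. *)
Lemma cubic_test_function (eps : R) : (1 < n)%N -> 0 < eps < 1 ->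
  0 <= alg_connectivity R G ->
  alg_connectivity R G *
    (2 * (1 - eps) * m%:R - eps^-1 * (theta ^+ 2 * (m%:R / 2))) <=
  theta ^+ 2 * m%:R / 4.
Proof.
move=> n1 /andP[e0 e1] mu0; have n0 : (0 < n)%N := ltnW n1.
pose F x := interpolation (layer x); pose c := (\sum_x F x) / n%:R.
have card_per j (jm : (j < m)%N) := card_period cardP jm.
have F0 : \sum_x (F x - c) = 0.
  rewrite sumrB sumr_const card_ord -mulr_natr /c divfK ?subrr //.
  by rewrite pnatr_eq0 -lt0n.
have := alg_connectivity_poincare G n1 F0; rewrite energyBc => muF.
have energy_le : energy G F <= theta ^+ 2 * m%:R / 4.
  apply: le_trans (layered_energy_le _) _.
  pose q i : R := if (i.+1 < 3 * m)%N then
    (#|P i| * #|P i.+1|)%:R * (interpolation i.+1 - interpolation i) ^+ 2 else 0.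
  have -> : \sum_(0 <= i < (3 * m).-1) (#|P i| * #|P i.+1|)%:R *
      (interpolation i.+1 - interpolation i) ^+ 2 = \sum_(0 <= i < 3 * m) q i.
    have K0 : (0 < 3 * m)%N by rewrite muln_gt0.
    rewrite -[in RHS](prednK K0) big_nat_recr //= {2}/q prednK // ltnn addr0.
    rewrite big_nat [RHS]big_nat; apply: eq_bigr => i /andP[_ iK].
    by rewrite /q ifT //; lia.
  rewrite sum_by_three.
  apply: (@le_trans _ _ (\sum_(0 <= j < m) g j ^+ 2 / 2)); last first.
    by rewrite -mulr_suml; have := sum_g; lra.
  rewrite big_nat [leRHS]big_nat; apply: ler_sum => j /andP[_ jm].
  have [c0 c1 c2] := card_per j jm.
  have i1 : ((3 * j).+1 < 3 * m)%N by lia.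
  have i2 : ((3 * j).+2 < 3 * m)%N by lia.
  rewrite /q i1 i2 interp0 interp1 interp2 c0 c1 c2 /pattern /=.
  have last_le : (if ((3 * j).+3 < 3 * m)%N then (1 * #|P (3 * j).+3|)%:R *
      (interpolation (3 * j).+3 - (h j + g j / 2)) ^+ 2 else 0) <= g j ^+ 2 / 4.
    have i3 : (3 * j).+3 = (3 * j.+1)%N by lia.
    rewrite i3; case: ltnP => jK; last by rewrite divr_ge0 ?sqr_ge0.
    have j1 : (j.+1 < m)%N by lia.
    have [-> _ _] := card_per j.+1 j1.
    rewrite interp0 mul1r /g j1 le_eqVlt; apply/orP; left; apply/eqP.
    by field.
  move: last_le; set l := (if _ then _ else _); rewrite muln1 mul1n => last_le.
  have -> : h j + g j / 4 - h j = g j / 4 by ring.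
  have -> : h j + g j / 2 - (h j + g j / 4) = g j / 4 by field.
  have -> : (g j / 4) ^+ 2 = g j ^+ 2 / 16 by field.
  by rewrite -[(3 - 1)%N]/2%N; move: last_le; move: (g j ^+ 2) l => x l; lra.
have var_ge : 2 * (1 - eps) * m%:R - eps^-1 * (theta ^+ 2 * (m%:R / 2)) <=
    \sum_x (F x - c) ^+ 2.
  rewrite (sum_vertices cover disAM disAB disMB join).
  apply: (@le_trans _ _ (\sum_(0 <= j < m)
     (4 * (1 - eps) * (h j - c) ^+ 2 - eps^-1 * g j ^+ 2))).
    rewrite sumrB -!mulr_sumr; apply: lerB; last first.
      by rewrite ler_wpM2l ?invr_ge0 ?(ltW e0).
    have : m%:R / 2 <= \sum_(0 <= j < m) (h j - c) ^+ 2.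
      rewrite -(cos_profile_sqr R m2).
      have -> : \sum_(0 <= j < m) (h j - c) ^+ 2 =
          \sum_(0 <= j < m) h j ^+ 2 - 2 * c * \sum_(0 <= j < m) h j +
          \sum_(0 <= j < m) c ^+ 2.
        by rewrite mulr_sumr -sumrB -big_split /=; apply: eq_bigr => j _; ring.
      rewrite (cos_profile_sum R m2) mulr0 subr0 lerDl.
      by apply: sumr_ge0 => j _; exact: sqr_ge0.
    have e1' : 0 <= 1 - eps by rewrite subr_ge0 ltW.
    by move: (\sum_(_ <= _ < _) _) => s; nra.
  rewrite -[leLHS]add0r; apply: lerD.
    by rewrite addr_ge0 // sumr_ge0 // => x _; rewrite sqr_ge0.
  rewrite big_nat [leRHS]big_nat; apply: ler_sum => j /andP[_ jm].
  have [c0 c1 c2] := card_per j jm.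
  have layer_sum i : (i < 3 * m)%N -> \sum_(x in P i) (F x - c) ^+ 2 =
      #|P i|%:R * (interpolation i - c) ^+ 2.
    move=> iK; rewrite mulr_natl -sumr_const; apply: eq_bigr => x xi.
    by rewrite /F (layerP iK xi).
  have i0 : (3 * j < 3 * m)%N by lia.
  have i1 : ((3 * j).+1 < 3 * m)%N by lia.
  have i2 : ((3 * j).+2 < 3 * m)%N by lia.
  rewrite !layer_sum // c0 c1 c2 interp0 interp1 interp2 /pattern /=.
  (* Over the four vertices the errors total [(2 / 16 + 1 / 4) * g^2 / eps], within the [g^2 / eps]
     allowed. *)
  have split t := sqr_split_ge (h j - c) t e0.
  have eV0 : 0 <= eps^-1 by rewrite invr_ge0 ltW.
  have s0 := split 0; have s1 := split (g j / 4); have s2 := split (g j / 2).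
  have -> : h j + g j / 4 - c = h j - c + g j / 4 by ring.
  have -> : h j + g j / 2 - c = h j - c + g j / 2 by ring.
  rewrite addr0 in s0.
  have : 0 <= eps^-1 * g j ^+ 2 by rewrite mulr_ge0 ?sqr_ge0.
  have q4 : eps^-1 * (g j / 4) ^+ 2 = eps^-1 * g j ^+ 2 / 16 by field; rewrite gt_eqF.
  have q2 : eps^-1 * (g j / 2) ^+ 2 = eps^-1 * g j ^+ 2 / 4 by field; rewrite gt_eqF.
  rewrite -(mulrA 4) -[(3 - 1)%N]/2%N.
  move: s0 s1 s2; rewrite expr0n /= mulr0 subr0 q4 q2.
  move: ((h j - c + g j / 4) ^+ 2) ((h j - c + g j / 2) ^+ 2) (eps^-1 * g j ^+ 2).
  move: ((1 - eps) * (h j - c) ^+ 2) ((h j - c) ^+ 2) => x y r s t; lra.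
apply: le_trans energy_le; apply: le_trans muF.
by rewrite ler_wpM2l.
Qed.

End CubicTestFunction.

Section LowerBound.
Variable R : realType.

Lemma relaxation_lower (H : mu_minimal_structure R) (e : R) : 0 < e ->
  exists N0 : nat, forall k, (N0 <= k)%N ->
    (1 - e) * aldous_fill_value R k.*2 <= max_relaxation_time R k.*2.
Proof.
move=> e_gt0; have [C1 [C2 struct]] := H 3%N isT.
(* This finite Poincare constant provides the positivity of mu, by which the proof later divides. *)
have [N1 N1P] := patterned_poincare C2 (isT : (3 <= 3)%N) (@ltr01 R).
pose eps : R := Num.min e 1 / 4.
have eps0 : 0 < eps by rewrite divr_gt0 // lt_min e_gt0 ltr01.
have eps_e : 4 * eps <= e by rewrite /eps mulrC divfK // ge_min lexx.
have eps_1 : 4 * eps <= 1 by rewrite /eps mulrC divfK // ge_min lexx orbT.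
clearbody eps.
(* The first summand makes [4 * m] at least [(1 - eps / 2) * n], the second makes the error
   [6 / eps] at most [eps] times the target; [C2 + 8] below forces [m >= 2]. *)
pose T : R := 2 * C2%:R / eps + 48 / (eps * eps) + 2.
exists (maxn (maxn C1 N1) (maxn (C2 + 8) (Num.truncn T).+1)) => k.
rewrite !geq_max => /andP[/andP[kC1 kN1] /andP[kC2 kT]].
set n := k.*2; have kn : (k <= n)%N by rewrite /n -addnn leq_addr.
have k2 : (2 <= k)%N by lia.
have [G1 [conn1 reg1]] := exists_cubic k2.
have [G Gmin] := exists_mu_minimal R conn1 reg1; have [conn reg _] := Gmin.
have [_ pat] := struct n G (leq_trans kC1 kn) Gmin.
have [K K0 [GK _]] := N1P n G (leq_trans kN1 kn) conn pat.
have n1 : (1 < n)%N by exact: leq_trans kn.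
have mu0 : 0 < alg_connectivity R G.
  by apply: lt_le_trans (alg_connectivity_ge n1 K0 GK); rewrite invr_gt0.
case: pat => [A [M [B [m [P]]]]].
case=> [[cover disAM disAB disMB] ABC [m0 join _ cardP] [exA exB] noAB].
have nV : n%:R = #|A|%:R + #|B|%:R + m%:R * 4 :> R.
  exact: (card_vertices R (isT : (3 <= 3)%N) cover disAM disAB disMB join cardP).
have nm : (n <= C2 + m * 4)%N by rewrite -(ler_nat R) nV natrD natrM lerD2r -natrD ler_nat.
have m2 : (2 <= m)%N by clear -nm kC2 kn; lia.
have eps01 : 0 < eps < 1 by rewrite eps0 /=; lra.
have test := cubic_test_function cover disAM disAB disMB m2 join cardP exA exB noAB n1
  eps01 (ltW mu0).
apply: le_trans (max_relaxation_time_ge R conn reg).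
rewrite (relaxation_timeE R n1 (isT : (0 < 3)%N) reg).
have pi0 : 0 < pi ^+ 2 :> R by rewrite exprn_gt0 // pi_gt0.
have m0' : 0 < m%:R :> R by rewrite ltr0n.
have Tn : T <= n%:R.
  by apply: le_trans (ltW (truncnS_gt T)) _; rewrite ler_nat (leq_trans kT).
have t1 : 0 <= 2 * C2%:R / eps by rewrite divr_ge0 ?mulr_ge0 // ltW.
have t2 : 0 <= 48 / (eps * eps) by rewrite divr_ge0 ?mulr_ge0 // ltW.
have n_ge1 : 1 <= n%:R :> R by move: Tn; rewrite /T; lra.
have nC : 2 * C2%:R <= eps * n%:R.
  by rewrite [leRHS]mulrC -ler_pdivrMr //; move: Tn; rewrite /T; lra.
have n48 : 48 <= eps * n%:R * eps.
  by rewrite -mulrA mulrCA -ler_pdivrMr ?mulr_gt0 //; move: Tn; rewrite /T; lra.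
have m_ge : (1 - eps / 2) * n%:R <= 4 * m%:R.
  have : n%:R <= C2%:R + m%:R * 4 :> R by rewrite -natrM -natrD ler_nat.
  by move: nC; move: (n%:R) (C2%:R) (m%:R) => x y z; nra.
have m_sqr : (1 - eps) * n%:R ^+ 2 <= 16 * m%:R ^+ 2.
  have -> : 16 * m%:R ^+ 2 = (4 * m%:R) ^+ 2 :> R by ring.
  apply: (@le_trans _ _ (((1 - eps / 2) * n%:R) ^+ 2)).
    rewrite exprMn ler_wpM2r ?sqr_ge0 //.
    have -> : (1 - eps / 2) ^+ 2 = 1 - eps + eps ^+ 2 / 4 by field.
    by rewrite lerDl divr_ge0 ?sqr_ge0.
  by rewrite ler_sqr ?nnegrE ?mulr_ge0 //; lra.
set V := aldous_fill_value R n.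
have V_ge : n%:R ^+ 2 / 8 <= V := aldous_fill_value_ge R n.
have eV : 6 / eps <= eps * V.
  rewrite ler_pdivrMr //; apply: (@le_trans _ _ (eps * (n%:R ^+ 2 / 8) * eps)); last first.
    by rewrite ler_wpM2r ?(ltW eps0) // ler_wpM2l // ltW.
  have : n%:R <= n%:R ^+ 2 :> R by rewrite expr2 ler_peMl.
  move=> nn; have : eps * n%:R * eps <= eps * n%:R ^+ 2 * eps.
    by rewrite ler_wpM2r ?(ltW eps0) // ler_wpM2l // ltW.
  have -> : eps * (n%:R ^+ 2 / 8) * eps = eps * n%:R ^+ 2 * eps / 8 by field.
  by move: n48; move: (eps * n%:R * eps) (eps * n%:R ^+ 2 * eps) => x y; lra.
have mainV : (1 - eps) ^+ 2 * V <= 24 * (1 - eps) * m%:R ^+ 2 / pi ^+ 2.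
  rewrite /V /aldous_fill_value; set p : R := pi ^+ 2 in pi0 *.
  have -> : (1 - eps) ^+ 2 * (3 * n%:R ^+ 2 / (2 * p)) =
    (3 / 2 * (1 - eps) / p) * ((1 - eps) * n%:R ^+ 2) by field; rewrite gt_eqF.
  have -> : 24 * (1 - eps) * m%:R ^+ 2 / p =
    (3 / 2 * (1 - eps) / p) * (16 * m%:R ^+ 2) by field; rewrite gt_eqF.
  have e1 : 0 <= 1 - eps by lra.
  by rewrite ler_wpM2l // divr_ge0 ?(ltW pi0) // mulr_ge0 // divr_ge0.
(* This is the lower bound for [3 / mu] that results from multiplying the test inequality by
   [12 m / pi^2]. *)
apply: (@le_trans _ _ (24 * (1 - eps) * m%:R ^+ 2 / pi ^+ 2 - 6 / eps)).
  have V0 : 0 <= V := aldous_fill_value_ge0 R n.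
  have : (1 - e) * V <= ((1 - eps) ^+ 2 - eps) * V.
    rewrite ler_wpM2r //; have -> : (1 - eps) ^+ 2 = 1 - 2 * eps + eps ^+ 2 by ring.
    by have := sqr_ge0 eps; lra.
  rewrite [X in _ <= X -> _]mulrBl; move: mainV eV.
  move: ((1 - eps) ^+ 2 * V) (eps * V) ((1 - e) * V) (_ / pi ^+ 2) (6 / eps) => *; lra.
rewrite ler_pdivlMr //.
move: test; rewrite /angle expr_div_n; set p : R := pi ^+ 2 in pi0 *.
set mu := alg_connectivity R G in mu0 *; move=> test.
have -> : (24 * (1 - eps) * m%:R ^+ 2 / p - 6 / eps) * mu =
   12 * m%:R / p * (mu * (2 * (1 - eps) * m%:R -
     eps^-1 * (p / m%:R ^+ 2 * (m%:R / 2)))).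
  by field; rewrite !gt_eqF.
apply: (@le_trans _ _ (12 * m%:R / p * (p / m%:R ^+ 2 * m%:R / 4))).
  exact: ler_wpM2l (divr_ge0 (mulr_ge0 (ler0n _ _) (ler0n _ _)) (ltW pi0)) _ _ test.
rewrite le_eqVlt; apply/orP; left; apply/eqP.
by field; rewrite !gt_eqF.
Qed.

End LowerBound.

Theorem theorem1 (R : realType) : mu_minimal_structure R -> aldous_fill R.
Proof.
move=> H; split.
  move=> e e0; have [N0 upper] := relaxation_upper H e0.
  near=> n; apply: max_relaxation_time_le.
    by rewrite mulr_ge0 ?aldous_fill_value_ge0 // addr_ge0 // ltW.
  move=> G d conn reg; apply: (upper n d) => //.
  by near: n; exact: nbhs_infty_ge.
apply/cvgrPdist_le => e e0.
have [N0 upper] := relaxation_upper H e0; have [N1 lower] := relaxation_lower H e0.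
near=> k.
have k0 : (0 < k)%N by near: k; exact: nbhs_infty_gt.
have kN0 : (N0 <= k.*2)%N.
  apply: (@leq_trans k); last by rewrite -addnn leq_addr.
  by near: k; exact: nbhs_infty_ge.
have kN1 : (N1 <= k)%N by near: k; exact: nbhs_infty_ge.
have V0 : 0 < aldous_fill_value R k.*2.
  by rewrite divr_gt0 ?mulr_gt0 ?exprn_gt0 ?pi_gt0 // ltr0n double_gt0.
have le_up : max_relaxation_time R k.*2 <= (1 + e) * aldous_fill_value R k.*2.
  apply: max_relaxation_time_le; first by rewrite mulr_ge0 ?(ltW V0) // addr_ge0 // ltW.
  by move=> G d conn reg; apply: (upper _ d).
have le_low := lower k kN1.
rewrite ler_norml lerBrDl lerBlDl addrC.
have : max_relaxation_time R k.*2 / aldous_fill_value R k.*2 <= 1 + e.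
  by rewrite ler_pdivrMr.
have : 1 - e <= max_relaxation_time R k.*2 / aldous_fill_value R k.*2.
  by rewrite ler_pdivlMr.
by move: (_ / _) => x; lra.
Unshelve. all: by end_near.
Qed.
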